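(* For every $h\in\mathcal H$, $$\zeta(h)=L_{\square(h)}(1/2)\qquad\text{and}\qquad \zeta^{\pm}(h)=L_{\nabla(h)}(\rho^{\pm1}),$$ where $\rho=e^{i\pi/3}$ (the second identity being one for each choice of sign).
   Context: **Shuffle algebra.** Let $\mathcal W$ be the set of all words in the letters $a,b$ (including the empty word $\emptyset$), and let $\mathcal H=\mathbf{Q}\mathcal W$ be the $\mathbf{Q}$-vector space with basis $\mathcal W$. The shuffle product $*$ is the bilinear product given on words $w=x_1\cdots x_n$, $w'=x_{n+1}\cdots x_{n+m}$ by the sum over all shuffles of $w$ and $w'$ (all interleavings preserving the order of letters in each word, counted with multiplicity). $(\mathcal H,* )$ is a commutative associative algebra with unit $\emptyset$. Let $\mathcal W^+$ be the set of words whose first letter is not $b$ (including $\emptyset$), $\mathcal W^{++}$ the set of words whose first letter is not $b$ and whose last letter is not $a$ (including $\emptyset$), $\mathcal H^+=\mathbf{Q}\mathcal W^+$, $\mathcal H^{++}=\mathbf{Q}\mathcal W^{++}$. These are subalgebras and $\mathcal H=\mathcal H^+[b]=\mathcal H^{++}[a,b]$ are polynomial algebras (for $*$). **Polylogarithms.** A nonempty $w\in\mathcal W^+$ is uniquely $w=ab^{t_1}ab^{t_2}\cdots ab^{t_k}$ with $t_i\ge0$; put $r_i=1+t_i$ and $L_w(z)=\sum_{0<n_1<\dots<n_k}n_1^{-r_1}\cdots n_k^{-r_k}z^{n_k}$ for $|z|<1$; $L_\emptyset=1$. $L_w$ extends continuously to $\{|z|\le1\}\setminus\{1\}$. Let $\Omega=\{|z|<1\}\setminus\,]-1,0]$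 and $\log z$ the holomorphic logarithm on $\Omega$ real on $]0,1[$. For $h\in\mathcal H$, $L_h(z)$ is the image of $h$ under the unique algebra morphism $(\mathcal H,* )\to\mathrm{Hol}(\Omega)$ sending $w\in\mathcal W^+$ to $L_w(z)$ and $b$ to $\log z$. The values $L_h(\rho^{\pm1})$ are those of the continuous extension of $L_h$ to the points $\rho^{\pm1}$ (with $\log\rho^{\pm1}=\pm i\pi/3$). **Polyzeta values.** For nonempty $w\in\mathcal W^{++}$ (so $r_k\ge2$), $\zeta(w)=\sum_{0<n_1<\dots<n_k}n_1^{-r_1}\cdots n_k^{-r_k}$; $\zeta(\emptyset)=1$. The maps $\zeta,\zeta^+,\zeta^-:\mathcal H\to\mathbf{C}$ are the unique algebra morphisms (for $*$) which send each $w\in\mathcal W^{++}$ to $\zeta(w)$, send $b$ to $0$, and satisfy $\zeta(a)=0$, $\zeta^+(a)=i\pi$, $\zeta^-(a)=-i\pi$. **The operators $\square,\nabla$.** Let $\Delta:\mathcal H\to\mathcal H\otimes\mathcal H$ be the linear map $\Delta(c_1\cdots c_n)=\sum_{0\le i\le n}c_1\cdots c_i\otimes c_{i+1}\cdots c_n$. Define $\sigma(a)=b$, $\sigma(b)=a$, $\tau(a)=a+b$, $\tau(b)=-a$, and extend to linear maps $\sigma,\tau:\mathcal H\to\mathcal H$ by $\sigma(c_1\cdots c_n)=\sigma(c_n)\cdots\sigma(c_1)$ and $\tau(c_1\cdots c_n)=\tau(c_n)\cdots\tau(c_1)$ (products being concatenation, extended bilinearly). Then $\square$ is the composite $\mathcal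 H\xrightarrow{\Delta}\mathcal H\otimes\mathcal H\xrightarrow{\mathrm{id}\otimes\sigma}\mathcal H\otimes\mathcal H\xrightarrow{*}\mathcal H$ and $\nabla$ is the composite $\mathcal H\xrightarrow{\Delta}\mathcal H\otimes\mathcal H\xrightarrow{\mathrm{id}\otimes\tau}\mathcal H\otimes\mathcal H\xrightarrow{*}\mathcal H$. *)

(* Defs.v *)
From HB Require Import structures.
From mathcomp Require Import all_boot all_order all_algebra.
From mathcomp Require Import finmap monalg complex.
From mathcomp Require Import all_classical all_reals all_analysis.

Set Implicit Arguments.
Unset Strict Implicit.
Unset Printing Implicit Defensive.

Import Order.TTheory GRing.Theory Num.Theory.
Import numFieldNormedType.Exports.

Local Open Scope classical_set_scope.
Local Open Scope ring_scope.
Local Open Scope complex_scope.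

Inductive letter := xa | xb.

Definition is_xb (c : letter) : bool := if c is xb then true else false.
Definition letter_of_bool (t : bool) : letter := if t then xb else xa.
Lemma is_xbK : cancel is_xb letter_of_bool. Proof. by case. Qed.
HB.instance Definition _ := Choice.copy letter (can_type is_xbK).

Notation word := (seq letter).

Definition H := {malg rat[word]}.

(* H (x) H, as the space with basis the pairs of words. *)
Definition HH := {malg rat[(word * word)%type]}.

Definition wd (w : word) : H := << w >>.

Definition linext (K : choiceType) (V : lmodType rat) (f : K -> V)
    (x : {malg rat[K]}) : V :=
  \sum_(k <- msupp x) x@_k *: f k.

Definition bilext (K : choiceType) (V : lmodType rat) (f : K -> K -> V)
    (x y : {malg rat[K]}) : V :=
  linext (fun u => linext (f u) y) x.

(* All interleavings of u and v, listed with multiplicity. *)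
Fixpoint interleavings (u : word) : word -> seq word :=
  if u is c :: u' then
    fix interleavings_u (v : word) : seq word :=
      if v is d :: v' then
        map (cons c) (interleavings u' v) ++ map (cons d) (interleavings_u v')
      else [:: u]
  else fun v => [:: v].

Definition shuffle : H -> H -> H :=
  bilext (fun u v => \sum_(w <- interleavings u v) wd w).

Definition concat : H -> H -> H := bilext (fun u v => wd (u ++ v)).

Definition tensor : H -> H -> HH := bilext (fun u v => << (u, v) >>).

Definition deconcat : H -> HH :=
  linext (fun w : word =>
    \sum_(i < (size w).+1) << (take i w, drop i w) >> : HH).

Definition shuffle_tensor : HH -> H :=
  linext (fun p : word * word => shuffle (wd p.1) (wd p.2)).

Definition id_tensor (f : H -> H) : HH -> HH :=
  linext (fun p : word * word => tensor (wd p.1) (f (wd p.2))).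

(* c_1 ... c_n |-> f(c_n) ... f(c_1), extended linearly. *)
Definition antiext (f : letter -> H) : H -> H :=
  linext (foldr (fun c x => concat x (f c)) (wd [::])).

Definition sigma : H -> H :=
  antiext (fun c => if c is xa then wd [:: xb] else wd [:: xa]).

Definition tau : H -> H :=
  antiext (fun c => if c is xa then wd [:: xa] + wd [:: xb] else - wd [:: xa]).

Definition square (h : H) : H := shuffle_tensor (id_tensor sigma (deconcat h)).

Definition nabla (h : H) : H := shuffle_tensor (id_tensor tau (deconcat h)).

Definition Wp : pred word := fun w => head xa w != xb.

Definition Wpp : pred word := fun w => (head xa w != xb) && (last xb w != xa).

Definition of_exponents (r : seq nat) : word :=
  flatten [seq xa :: nseq i.-1 xb | i <- r].

(* The number of leading letters b, and the sequence r_1, ..., r_k read off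
   from the remaining word a b^(r_1 - 1) ... a b^(r_k - 1). *)
Fixpoint parse (w : word) : nat * seq nat :=
  match w with
  | [::] => (0%N, [::])
  | xa :: w' => (0%N, (parse w').1.+1 :: (parse w').2)
  | xb :: w' => ((parse w').1.+1, (parse w').2)
  end.

Definition exponents (w : word) : seq nat := (parse w).2.

Lemma exponentsK (w : word) : Wp w -> of_exponents (exponents w) = w.
Proof.
rewrite /exponents; suff E (u : word) :
    nseq (parse u).1 xb ++ of_exponents (parse u).2 = u.
  by case: w => [|[] w] //= _; congr cons; exact: E.
by elim: u => [|[] u IH] //=; rewrite -{3}IH.
Qed.

Section Analysis.
Variable R : realType.

(* The structure of normed module over the field R[i] is carried by R[i]^o. *)
Notation C := (R[i])^o.

Definition unit_disk : set C := [set z | `|z| < 1].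

Definition Omega : set C := unit_disk `\` [set x%:C | x in `]-1, 0]%classic].

Definition holomorphic (U : set C) (f : C -> C) : Prop :=
  forall z, U z -> derivable f z 1.

Definition cexp (z : C) : C :=
  (expR (complex.Re z))%:C * (cos (complex.Im z) +i* sin (complex.Im z)).

(* Principal argument, in ]-pi, pi] for z != 0. *)
Definition arg (z : C) : R :=
  let t := acos (complex.Re z / ComplexField.Normc.normc z) in
  if 0 <= complex.Im z then t else - t.

(* The principal logarithm; its restriction to Omega is the holomorphic
   logarithm that is real on ]0, 1[. *)
Definition clog (z : C) : C := ln (ComplexField.Normc.normc z) +i* arg z.

Lemma cexp_clog (z : C) : z != 0 -> cexp (clog z) = z.
Proof.
case: z => x y z0; have n0 : 0 < ComplexField.Normc.normc (x +i* y).
  rewrite lt_neqAle eq_sym [X in _ && X]sqrtr_ge0 andbT.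
  by apply: contraNN z0 => /eqP/ComplexField.Normc.eq0_normc ->.
have n2 : x ^+ 2 + y ^+ 2 = ComplexField.Normc.normc (x +i* y) ^+ 2.
  by rewrite /= sqr_sqrtr // addr_ge0 ?sqr_ge0.
rewrite /cexp /clog /= lnK ?posrE // /arg /=.
move: n0 n2; rewrite /=; set n := Num.sqrt _ => n0 n2.
have xn : -1 <= x / n <= 1.
  rewrite -ler_norml normrM normfV (gtr0_norm n0) ler_pdivrMr // mul1r.
  rewrite -(@ler_pXn2r _ 2) ?nnegrE ?normr_ge0 ?(ltW n0) // real_normK ?num_real //.
  by rewrite -n2 lerDl sqr_ge0.
have sn : sin (acos (x / n)) = `|y| / n.
  rewrite sin_acos //; have -> : 1 - (x / n) ^+ 2 = (y / n) ^+ 2.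
    rewrite !expr_div_n -[X in X - _](@divff _ (n ^+ 2)) ?expf_neq0 ?gt_eqF //.
    by rewrite -mulrBl -n2 addrC addKr.
  by rewrite sqrtr_sqr normrM normfV (gtr0_norm n0).
have nn : n != 0 by rewrite gt_eqF.
have E t : cos t = x / n -> sin t = y / n -> n%:C * (cos t +i* sin t) = x +i* y.
  move=> -> ->; apply/eqP; rewrite eq_complex /= !mul0r subr0 addr0.
  by rewrite ![n * _]mulrC !divfK // !eqxx.
case: ifP => y0; apply: E; rewrite ?cosN ?sinN ?acosK ?sn ?in_itv //=.
  by rewrite ger0_norm.
by rewrite ltr0_norm ?mulNr ?opprK // ltNge y0.
Qed.

(* The sum over 0 < n_1 < ... < n_k < N of
   n_1^(-r_1) ... n_k^(-r_k) z^(n_k), where k = size r; it is 1 if k = 0. *)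
Definition Li_trunc (r : seq nat) (z : C) (N : nat) : C :=
  \sum_(n : (size r).-tuple 'I_N | path ltn 0%N (map val n))
    (\prod_(i < size r) (tnth n i)%:R ^- (nth 0%N r i)) *
    z ^+ last 0%N (map val n).

Definition Li (r : seq nat) (z : C) : C := lim (Li_trunc r z @ \oo).

(* Morphisms of Q-algebras with unit from (H, shuffle) to the complex numbers. *)
Definition shuffle_morphism (f : H -> C) : Prop :=
  [/\ f (wd [::]) = 1,
      forall (q : rat) (x y : H), f (q *: x + y) = ratr q * f x + f y
    & forall x y : H, f (shuffle x y) = f x * f y].

(* Only the restriction of L h to Omega is meaningful. *)
Definition is_polylog (L : H -> C -> C) : Prop :=
  [/\ forall h, holomorphic Omega (L h),
      forall z, Omega z -> shuffle_morphism (fun h => L h z),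
      forall w, Wp w ->
        forall z, Omega z -> L (wd w) z = Li (exponents w) z
    & forall z, Omega z -> L (wd [:: xb]) z = clog z].

(* The morphism h |-> L_h, by definite description: H is the polynomial algebra
   over the span of Wp generated by b, so is_polylog determines L h on Omega. *)
Definition polylog : H -> C -> C := xget (fun _ _ => 0) is_polylog.

(* At z = 1 the series Li is the multiple zeta series. H is the polynomial
   algebra over the span of Wpp generated by a and b, so is_zeta v holds for
   exactly one f. *)
Definition is_zeta (v : C) (f : H -> C) : Prop :=
  [/\ shuffle_morphism f,
      forall w, Wpp w -> f (wd w) = Li (exponents w) 1,
      f (wd [:: xb]) = 0
    & f (wd [:: xa]) = v].

Definition zeta_reg (v : C) : H -> C := xget (fun _ => 0) (is_zeta v).

Definition zeta : H -> C := zeta_reg 0.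
Definition zeta_plus : H -> C := zeta_reg ('i * pi%:C).
Definition zeta_minus : H -> C := zeta_reg (- ('i * pi%:C)).

Definition rho : C := cexp ('i * (pi / 3)%:C).

(* v is the value at z0, in the closure of Omega, of the continuous extension
   of f from Omega. *)
Definition extension_value (f : C -> C) (z0 v : C) : Prop :=
  f z @[z --> within Omega (nbhs z0)] --> v.

End Analysis.

(* Main.v *)
(** For w = c_1 ... c_n, the sum F_w(z) of the products
    L_(c_1 ... c_i)(z) L_(s(c_(i+1) ... c_n))(T z), with (s, T z) = (sigma, 1 - z)
    or (tau, 1 - 1/z), does not depend on z: the substitution s is the one
    which turns the forms dz/(1-z), dz/z pulled back by T into the opposite of
    the original ones, so that the derivative telescopes.  If w starts with a
    and ends with b, every term but the last is O((1 - z) L_u(z)) as z -> 1,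
    hence tends to 0 since the power series coefficients of L_u tend to 0,
    and the last one tends to zeta(w).  So F_w(z) = zeta(w).  For fixed z, F is
    a convolution of two morphisms, hence a morphism; computing it at a and b
    with the logarithm identifies it with the regularised zeta, because H is
    generated by a, b and the words of Wpp.  For T z = 1 - z this is evaluated
    at the fixed point 1/2.  For T z = 1 - 1/z it holds in the convex domains
    |z| < 1, Re z > 1/2, +-Im z > 0, and one lets z tend to the fixed point
    rho^(+-1) on their boundary. *)
Require Import Defs.
From HB Require Import structures.
From mathcomp Require Import all_boot all_order all_algebra.
From mathcomp Require Import finmap monalg complex.
From mathcomp Require Import all_classical all_reals all_analysis.
From mathcomp Require Import ring lra.
Set Implicit Arguments.
Unset Strict Implicit.
Unset Printing Implicit Defensive.
Import Order.TTheory GRing.Theory Num.Theory.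
Import numFieldNormedType.Exports.
Local Open Scope ring_scope.

(** * Sums over shuffles *)

Section ShuffleSums.
Variable V : zmodType.
Implicit Types (u v w : word) (G : word -> V).

(** Both [polylog] and [zeta_reg] are selected by [xget], so each needs a witness. For [polylog], w
    |-> L_w has to be extended from Wp to H with a prescribed value at b; this works because the
    product of b with b^m w contains b^(m+1) w with coefficient m + 1, invertible in Q. For
    [zeta_reg] the witness is F itself, so no regularised zeta is built beforehand. Multiplicativity
    is proved for functions on words summed over interleavings, and carried to H by linear extension
    afterwards. For w in Wpp no logarithm enters F_w: a nonempty right-hand piece ends with b, so
    its image under s consists of words beginning with a, whose L is a power series in T z vanishing
    at 0. A left-hand piece u may end with a and L_u may be unbounded near 1, but (1 - z) L_u has
    absolutely summable coefficients; the same fact gives the boundary values at |z| = 1, z <> 1.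
    For T z = 1 - 1/z the real axis must be left out, since T sends ]1/2, 1[ into the cut ]-1, 0].
    The choice of a half-plane is what produces the two signs of i pi. *)

Definition shsum u v G : V := \sum_(w <- interleavings u v) G w.

Lemma shsum0s v G : shsum [::] v G = G v.
Proof. by rewrite /shsum big_seq1. Qed.

Lemma shsums0 u G : shsum u [::] G = G u.
Proof. by case: u => [|c u]; rewrite /shsum big_seq1. Qed.

Lemma shsum_cons c d u v G :
  shsum (c :: u) (d :: v) G =
  shsum u (d :: v) (G \o cons c) + shsum (c :: u) v (G \o cons d).
Proof. by rewrite /shsum /= big_cat !big_map. Qed.

Lemma eq_shsum u v G1 G2 : G1 =1 G2 -> shsum u v G1 = shsum u v G2.
Proof. by move=> e; apply: eq_bigr. Qed.

Lemma shsumD u v G1 G2 :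
  shsum u v (fun w => G1 w + G2 w) = shsum u v G1 + shsum u v G2.
Proof. exact: big_split. Qed.

Lemma shsumC u v G : shsum u v G = shsum v u G.
Proof.
elim: u v G => [|c u IHu] v G; first by rewrite shsum0s shsums0.
elim: v G => [|d v IHv] G; first by rewrite shsum0s shsums0.
by rewrite !shsum_cons IHu IHv addrC.
Qed.

(** [interleavings] recurses on first letters, but L_w is differentiated at its last letter and the
    substitutions reverse words; this is the recursion on last letters that both need. *)
Lemma shsum_rcons c d u v G :
  shsum (rcons u c) (rcons v d) G =
  shsum u (rcons v d) (G \o rcons^~ c) + shsum (rcons u c) v (G \o rcons^~ d).
Proof.
elim: u v G => [|e u IHu] v G.
  elim: v G => [|f v IHv] G.
    by rewrite /= shsum_cons !shsum0s !shsums0 /= addrC.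
  rewrite /= in IHv *; by rewrite !shsum_cons !shsum0s IHv /= shsum0s addrCA.
elim: v G => [|f v IHv] G.
  rewrite /= shsum_cons (IHu [::]) /= !shsums0 shsum_cons /= !shsums0 /=.
  by rewrite -!addrA; congr (_ + _); rewrite addrC.
rewrite /= in IHv *; rewrite shsum_cons (IHu (f :: v)) IHv !shsum_cons.
by rewrite -!addrA; congr (_ + _); rewrite addrCA.
Qed.

(** Both sides run over the interleavings of three words; each is split according to which of the
    three supplies the first letter. *)
Lemma shsumA u v w G :
  shsum u v (fun x => shsum x w G) = shsum v w (fun y => shsum u y G).
Proof.
elim: u v w G => [|c u IHu] v w G.
  by rewrite shsum0s; apply: eq_shsum => y; rewrite shsum0s.
elim: v w G => [|d v IHv] w G; first by rewrite shsums0 shsum0s.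
elim: w G => [|e w IHw] G.
  by rewrite shsums0; apply: eq_shsum => x; rewrite shsums0.
have El (c' : letter) (x y : word) :
    shsum x y ((fun z => shsum z (e :: w) G) \o cons c') =
    shsum x y (fun z => shsum z (e :: w) (G \o cons c')) +
    shsum x y ((fun z => shsum z w (G \o cons e)) \o cons c').
  by rewrite -shsumD; apply: eq_shsum => z /=; rewrite shsum_cons.
have Er (c' : letter) (x y : word) :
    shsum x y ((fun z => shsum (c :: u) z G) \o cons c') =
    shsum x y ((fun z => shsum u z (G \o cons c)) \o cons c') +
    shsum x y (fun z => shsum (c :: u) z (G \o cons c')).
  by rewrite -shsumD; apply: eq_shsum => z /=; rewrite shsum_cons.
rewrite shsum_cons !El addrACA -shsum_cons.
rewrite (shsum_cons d e v w) (Er d) (Er e).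
by rewrite IHw IHu IHv [RHS]addrACA -(shsum_cons d e v w) addrA.
Qed.

Fixpoint splits w : seq (word * word) :=
  if w is c :: w' then
    ([::], w) :: [seq (c :: p.1, p.2) | p <- splits w']
  else [:: ([::], [::])].

Lemma sum_splits_cons c w (g : word -> word -> V) :
  \sum_(p <- splits (c :: w)) g p.1 p.2 =
  g [::] (c :: w) + \sum_(p <- splits w) g (c :: p.1) p.2.
Proof. by rewrite big_cons big_map. Qed.

(** Deconcatenation is a morphism for the shuffle product: a cut of an interleaving of u and v is a
    cut of u, a cut of v, and an interleaving on each side. *)
Lemma shsum_splits u v (g : word -> word -> V) :
  shsum u v (fun w => \sum_(p <- splits w) g p.1 p.2) =
  \sum_(p <- splits u) \sum_(q <- splits v)
    shsum p.1 q.1 (fun x => shsum p.2 q.2 (g x)).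
Proof.
elim: u v g => [|c u IHu] v g.
  rewrite shsum0s big_seq1; apply: eq_bigr => q _.
  by rewrite !shsum0s.
elim: v g => [|d v IHv] g.
  rewrite shsums0; apply: eq_bigr => p _; rewrite big_seq1.
  by rewrite !shsums0.
rewrite shsum_cons.
have E1 e : (fun w => \sum_(p <- splits w) g p.1 p.2) \o cons e =1
    (fun w => g [::] (e :: w) + \sum_(p <- splits w) g (e :: p.1) p.2).
  by move=> w /=; rewrite sum_splits_cons.
rewrite !(eq_shsum _ _ (E1 _)) !shsumD addrACA.
rewrite (IHu _ (fun x y => g (c :: x) y)) (IHv (fun x y => g (d :: x) y)).
rewrite (sum_splits_cons c u (fun p1 p2 => \sum_(q <- splits (d :: v))
    shsum p1 q.1 (fun x => shsum p2 q.2 (g x)))).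
rewrite (sum_splits_cons c u (fun p1 p2 => \sum_(q <- splits v)
    shsum p1 q.1 (fun x => shsum p2 q.2 (g (d :: x))))).
have E2 p1 p2 : \sum_(q <- splits (d :: v))
      shsum p1 q.1 (fun x => shsum p2 q.2 (g x)) =
    shsum p1 [::] (fun x => shsum p2 (d :: v) (g x)) + \sum_(q <- splits v)
     shsum p1 (d :: q.1) (fun x => shsum p2 q.2 (g x)).
  by rewrite (sum_splits_cons d v (fun q1 q2 => shsum p1 q1 (fun x => shsum p2 q2 (g x)))).
rewrite E2 shsum0s -shsum_cons -!addrA; congr (_ + _).
rewrite addrCA; congr (_ + _).
  by apply: eq_bigr => q _; rewrite !shsum0s.
rewrite -big_split /=; apply: eq_bigr => p _.
rewrite E2.
rewrite (sum_splits_cons d v (fun q1 q2 => shsum p.1 q1 (fun x => shsum p.2 q2 (g (c :: x))))).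
rewrite -addrA !shsums0; congr (_ + _).
by rewrite -big_split /=; apply: eq_bigr => q _; rewrite shsum_cons.
Qed.

Lemma sum_splits_take w (g : word -> word -> V) :
  \sum_(p <- splits w) g p.1 p.2 = \sum_(i < (size w).+1) g (take i w) (drop i w).
Proof.
elim: w g => [|c w IHw] g; first by rewrite big_seq1 big_ord_recl big_ord0 addr0.
by rewrite sum_splits_cons (IHw (fun x y => g (c :: x) y)) [RHS]big_ord_recl.
Qed.

End ShuffleSums.

(** * Linear maps and morphisms on H *)

Section LinearExtension.
Variables (K : choiceType) (V : zmodType).

Lemma sum_msuppE (F : K -> rat -> V) (d : {fset K}) (x : {malg rat[K]}) :
  (forall k, F k 0 = 0) -> (msupp x `<=` d)%fset ->
  \sum_(k <- msupp x) F k x@_k = \sum_(k <- d) F k x@_k.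
Proof.
move=> F0 le; rewrite [LHS](big_fset_incl _ le) //.
by move=> k _ /mcoeff_outdom ->; rewrite F0.
Qed.

Lemma sum_msuppP (F : K -> rat -> V) (x y : {malg rat[K]}) (q : rat) :
  (forall k a b, F k (a + b) = F k a + F k b) ->
  \sum_(k <- msupp (q *: x + y)) F k (q *: x + y)@_k =
  \sum_(k <- msupp x) F k (q * x@_k) + \sum_(k <- msupp y) F k y@_k.
Proof.
move=> FD; have F0 k : F k 0 = 0 by apply: (addrI (F k 0)); rewrite -FD !addr0.
set d := (msupp x `|` msupp y)%fset.
have dx : (msupp x `<=` d)%fset by exact: fsubsetUl.
have dy : (msupp y `<=` d)%fset by exact: fsubsetUr.
have dxy : (msupp (q *: x + y) `<=` d)%fset.
  apply: fsubset_trans (msuppD_le _ _) _; rewrite fsubUset dy andbT.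
  exact: fsubset_trans (msuppZ_le _ _) dx.
rewrite (sum_msuppE F0 dxy) (sum_msuppE (F := F) F0 dy).
rewrite (sum_msuppE (F := fun k a => F k (q * a)) _ dx) => [|k]; last by rewrite mulr0.
by rewrite -big_split /=; apply: eq_bigr => k _; rewrite mcoeffD mcoeffZ FD.
Qed.
End LinearExtension.

Section Linext.
Variables (K : choiceType) (V : lmodType rat).
Implicit Types (f : K -> V) (x y : {malg rat[K]}).

Lemma linextP f q x y : linext f (q *: x + y) = q *: linext f x + linext f y.
Proof.
rewrite /linext (sum_msuppP (F := fun k a => a *: f k)); last first.
  by move=> k a b /=; rewrite scalerDl.
by rewrite scaler_sumr; congr (_ + _); apply: eq_bigr => k _; rewrite scalerA.
Qed.

Lemma linextU f k : linext f << k >> = f k.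
Proof. by rewrite /linext msuppU oner_eq0 big_seq_fset1 mcoeffUU scale1r. Qed.

End Linext.

Lemma malg_sum (K : choiceType) (x : {malg rat[K]}) : x = \sum_(k <- msupp x) x@_k *: << k >>.
Proof.
rewrite [LHS]monalgE; apply: eq_bigr => k _.
by apply/malgP => k'; rewrite mcoeffZ !mcoeffU mulrnAr mulr1.
Qed.

Section QLinear.
Variables (F : numFieldType) (K : choiceType).
Implicit Types (f : {malg rat[K]} -> F) (phi : K -> F).

Definition qlinear f :=
  forall (q : rat) (x y : {malg rat[K]}), f (q *: x + y) = ratr q * f x + f y.

Lemma qlinearD f x y : qlinear f -> f (x + y) = f x + f y.
Proof. by move=> fl; rewrite -[x]scale1r fl rmorph1 mul1r scale1r. Qed.

Lemma qlinear0 f : qlinear f -> f 0 = 0.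
Proof.
by move=> fl; apply: (addrI (f 0)); rewrite -(qlinearD _ _ fl) !addr0.
Qed.

Lemma qlinearZ f q x : qlinear f -> f (q *: x) = ratr q * f x.
Proof. by move=> fl; rewrite -[q *: x]addr0 fl (qlinear0 fl) addr0. Qed.

Lemma qlinear_sum f I (s : seq I) (P : pred I) (g : I -> {malg rat[K]}) :
  qlinear f -> f (\sum_(i <- s | P i) g i) = \sum_(i <- s | P i) f (g i).
Proof.
move=> fl; apply: (big_morph f) => [x y|]; [exact: qlinearD|exact: qlinear0].
Qed.

(** The counterpart of [linext] for values in a field, on which the rational coefficients act
    through [ratr]. *)
Definition qext phi (x : {malg rat[K]}) : F :=
  \sum_(k <- msupp x) ratr x@_k * phi k.

Lemma qext_qlinear phi : qlinear (qext phi).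
Proof.
move=> q x y; rewrite /qext (sum_msuppP (F := fun k a => ratr a * phi k)).
  by rewrite big_distrr /=; congr (_ + _); apply: eq_bigr => k _; rewrite rmorphM mulrA.
by move=> k a b /=; rewrite rmorphD mulrDl.
Qed.

Lemma qextU phi k : qext phi << k >> = phi k.
Proof. by rewrite /qext msuppU oner_eq0 big_seq_fset1 mcoeffUU rmorph1 mul1r. Qed.

Lemma qlinearE f x : qlinear f -> f x = qext (fun k => f << k >>) x.
Proof.
move=> fl; rewrite {1}(malg_sum x) (qlinear_sum _ _ _ fl).
by apply: eq_bigr => k _; rewrite (qlinearZ _ _ fl).
Qed.

Lemma eq_qext phi1 phi2 x : phi1 =1 phi2 -> qext phi1 x = qext phi2 x.
Proof. by move=> e; apply: eq_bigr => k _; rewrite e. Qed.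
End QLinear.

Lemma qlinear_linext (F : numFieldType) (K K' : choiceType)
    (f : {malg rat[K]} -> F) (g : K' -> {malg rat[K]}) (x : {malg rat[K']}) :
  qlinear f -> f (linext g x) = qext (fun k => f (g k)) x.
Proof.
move=> fl; rewrite (qlinear_sum _ _ _ fl); apply: eq_bigr => k _.
by rewrite (qlinearZ _ _ fl).
Qed.

Section Shuffle.
Variable F : numFieldType.
Implicit Types (f : H -> F) (phi : word -> F) (u v w : word).

Lemma shuffle_wd u v : shuffle (wd u) (wd v) = shsum u v wd.
Proof. by rewrite /shuffle /bilext !linextU. Qed.

Lemma qlinear_shsum f u v (g : word -> H) :
  qlinear f -> f (shsum u v g) = shsum u v (f \o g).
Proof. by move=> fl; rewrite (qlinear_sum _ _ _ fl). Qed.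

Lemma qlinear_shuffle f x y : qlinear f ->
  f (shuffle x y) =
  qext (fun u => qext (fun v => shsum u v (f \o wd)) y) x.
Proof.
move=> fl; rewrite (qlinear_linext _ _ fl); apply: eq_qext => u.
by rewrite (qlinear_linext _ _ fl); apply: eq_qext => v; rewrite qlinear_shsum.
Qed.

Definition word_morphism phi :=
  phi [::] = 1 /\ forall u v, shsum u v phi = phi u * phi v.

Definition alg_morphism f :=
  [/\ f (wd [::]) = 1, qlinear f & forall x y, f (shuffle x y) = f x * f y].

Lemma word_morphismP f : alg_morphism f -> word_morphism (f \o wd).
Proof.
move=> [f1 fl fM]; split=> // u v.
by rewrite -(qlinear_shsum _ _ _ fl) -shuffle_wd fM.
Qed.

Lemma qext_mul phi psi x y :
  qext (fun u => qext (fun v => phi u * psi v) y) x = qext phi x * qext psi y.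
Proof.
rewrite /qext big_distrl; apply: eq_bigr => u _ /=.
by rewrite !mulr_sumr; apply: eq_bigr => v _; ring.
Qed.

Lemma qext_morphism phi : word_morphism phi -> alg_morphism (qext phi).
Proof.
move=> [phi1 phiM]; split; [by rewrite qextU|exact: qext_qlinear|].
move=> x y; rewrite (qlinear_shuffle _ _ (qext_qlinear phi)) -qext_mul.
apply: eq_qext => u; apply: eq_qext => v; rewrite -phiM.
by apply: eq_shsum => w /=; rewrite qextU.
Qed.
End Shuffle.

(** * Letter substitutions, square and nabla *)

Section Substitution.
Variable phi : letter -> seq (rat * letter).

Definition lettersum (c : letter) : H := \sum_(q <- phi c) q.1 *: wd [:: q.2].

(** The image of a word under the anti-morphism, kept as a list of weighted words so that the
    letters of each term stay visible. The first letter of w gives the last letter of each term. *)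
Fixpoint subst_word (w : word) : seq (rat * word) :=
  if w is c :: w' then
    [seq (p.1 * q.1, rcons p.2 q.2) | q <- phi c, p <- subst_word w']
  else [:: (1, [::])].

Lemma concat_sum (I J : Type) (s : seq I) (t : seq J) (f : I -> rat * word)
    (g : J -> rat * word) :
  concat (\sum_(i <- s) (f i).1 *: wd (f i).2) (\sum_(j <- t) (g j).1 *: wd (g j).2) =
  \sum_(i <- s) \sum_(j <- t) ((f i).1 * (g j).1) *: wd ((f i).2 ++ (g j).2).
Proof.
have lin0 (h : word -> H) : linext h 0 = 0.
  by apply: (addrI (linext h 0)); rewrite -{1}[linext h 0]scale1r -linextP scale1r !addr0.
have linS (h : word -> H) (K : Type) (r : seq K) (k : K -> rat * word) :
    linext h (\sum_(i <- r) (k i).1 *: wd (k i).2) =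
    \sum_(i <- r) (k i).1 *: h (k i).2.
  elim: r => [|i r IH]; first by rewrite !big_nil lin0.
  by rewrite !big_cons linextP linextU IH.
rewrite /concat /bilext linS; apply: eq_bigr => i _.
by rewrite linS scaler_sumr; apply: eq_bigr => j _; rewrite scalerA.
Qed.

Lemma antiext_wd w :
  antiext lettersum (wd w) = \sum_(p <- subst_word w) p.1 *: wd p.2.
Proof.
rewrite /antiext linextU; elim: w => [|c w IHw].
  by rewrite big_seq1 scale1r.
rewrite /= IHw /lettersum.
rewrite (concat_sum _ _ (fun p => p) (fun q : rat * letter => (q.1, [:: q.2]))) /=.
rewrite exchange_big big_allpairs_dep /=.
by apply: eq_bigr => q _; apply: eq_bigr => p _; rewrite cats1.
Qed.

Variable F : numFieldType.
Implicit Types (G : word -> F) (u v w : word).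

Definition subst_fun G w : F := \sum_(p <- subst_word w) ratr p.1 * G p.2.

Lemma subst_fun_cons G c w :
  subst_fun G (c :: w) =
  \sum_(q <- phi c) ratr q.1 * subst_fun (G \o rcons^~ q.2) w.
Proof.
rewrite /subst_fun /= big_allpairs_dep /=; apply: eq_bigr => q _.
rewrite mulr_sumr; apply: eq_bigr => p _ /=.
by rewrite rmorphM /=; ring.
Qed.

(** Reversal and letterwise linear substitution both respect interleavings. In the induction, the
    first letters peeled off on the left by [shsum_cons] become last letters on the right, where
    [shsum_rcons] applies. *)
Lemma shsum_subst_fun u v G :
  shsum u v (subst_fun G) =
  subst_fun (fun x => subst_fun (fun y => shsum x y G) v) u.
Proof.
have sumC (I : Type) (s : seq I) (a : I -> F) (g : I -> word -> F) x y :
    shsum x y (fun w => \sum_(i <- s) a i * g i w) =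
    \sum_(i <- s) a i * shsum x y (g i).
  by rewrite /shsum exchange_big; apply: eq_bigr => i _; rewrite mulr_sumr.
have subC (I : Type) (s : seq I) (a : I -> F) (g : I -> word -> F) x :
    subst_fun (fun w => \sum_(i <- s) a i * g i w) x =
    \sum_(i <- s) a i * subst_fun (g i) x.
  rewrite /subst_fun; under eq_bigr do rewrite mulr_sumr.
  rewrite exchange_big; apply: eq_bigr => i _; rewrite mulr_sumr.
  by apply: eq_bigr => p _; rewrite mulrCA.
have subD (g h : word -> F) x :
    subst_fun (fun w => g w + h w) x = subst_fun g x + subst_fun h x.
  by rewrite /subst_fun -big_split; apply: eq_bigr => p _; rewrite mulrDr.
have subE (g h : word -> F) x : g =1 h -> subst_fun g x = subst_fun h x.
  by move=> e; apply: eq_bigr => p _; rewrite e.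
have sub0 g : subst_fun g [::] = g [::].
  by rewrite /subst_fun big_seq1 rmorph1 mul1r.
elim: u v G => [|c u IHu] v G.
  by rewrite shsum0s sub0; apply: (subE _ _) => y; rewrite shsum0s.
elim: v G => [|d v IHv] G.
  by rewrite shsums0; apply: (subE _ _) => x; rewrite sub0 shsums0.
have E c' x y : shsum x y (subst_fun G \o cons c') =
    \sum_(q <- phi c') ratr q.1 * shsum x y (subst_fun (G \o rcons^~ q.2)).
  by rewrite -sumC; apply: eq_shsum => w /=; rewrite subst_fun_cons.
rewrite shsum_cons !E subst_fun_cons.
rewrite [X in _ + X](_ : _ = \sum_(q <- phi c) ratr q.1 *
    subst_fun (fun x => \sum_(s <- phi d) ratr s.1 *
      subst_fun (fun y => shsum (rcons x q.2) y (G \o rcons^~ s.2)) v) u); last first.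
  under eq_bigr do rewrite IHv.
  by rewrite -subC subst_fun_cons.
rewrite -big_split; apply: eq_bigr => q _ /=.
rewrite -mulrDr IHu -subD; congr (_ * _); apply: (subE _ _) => x /=.
rewrite !subst_fun_cons -big_split; apply: eq_bigr => s _ /=.
rewrite -mulrDr -subD; congr (_ * _); apply: (subE _ _) => y /=.
by rewrite shsum_rcons.
Qed.

Lemma subst_fun_morphism f : word_morphism f -> word_morphism (subst_fun f).
Proof.
move=> [f1 fM]; split=> [|u v].
  by rewrite /subst_fun big_seq1 rmorph1 mul1r.
rewrite shsum_subst_fun /subst_fun mulr_suml; apply: eq_bigr => p _ /=.
rewrite !mulr_sumr. by apply: eq_bigr => q _; rewrite fM; ring.
Qed.

Definition convol (f g : word -> F) w : F := \sum_(p <- splits w) f p.1 * g p.2.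

(** By [shsum_splits], together with the commutativity of F. *)
Lemma convol_morphism f g :
  word_morphism f -> word_morphism g -> word_morphism (convol f g).
Proof.
move=> [f1 fM] [g1 gM]; split=> [|u v]; first by rewrite /convol big_seq1 f1 g1 mulr1.
rewrite (shsum_splits u v (fun x y => f x * g y)) /convol mulr_suml.
apply: eq_bigr => p _; rewrite mulr_sumr; apply: eq_bigr => q _.
rewrite mulrACA -fM -gM /shsum mulr_suml; apply: eq_bigr => x _.
by rewrite mulr_sumr.
Qed.

(** The common form of [square] and [nabla]. *)
Definition twist (h : H) : H :=
  shuffle_tensor (id_tensor (antiext lettersum) (deconcat h)).

Lemma alg_morphism_twist (f : H -> F) h : alg_morphism f ->
  f (twist h) = qext (convol (f \o wd) (subst_fun (f \o wd))) h.
Proof.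
move=> [f1 fl fM].
pose g (p : word * word) := f (wd p.1) * f (wd p.2).
have gt x y : qext g (tensor x y) = f x * f y.
  rewrite (qlinear_linext _ _ (qext_qlinear g)) [f x](qlinearE _ fl) [f y](qlinearE _ fl).
  rewrite -qext_mul; apply: eq_qext => u.
  rewrite (qlinear_linext _ _ (qext_qlinear g)); apply: eq_qext => v.
  by rewrite qextU.
have E x : f (shuffle_tensor x) = qext g x.
  by rewrite (qlinear_linext _ _ fl); apply: eq_qext => p; rewrite fM.
rewrite E (qlinear_linext _ _ (qext_qlinear g)) (qlinear_linext _ _ (qext_qlinear _)).
apply: eq_qext => w; rewrite (qlinear_sum _ _ _ (qext_qlinear _)).
rewrite /convol (sum_splits_take w (fun x y => f (wd x) * subst_fun (f \o wd) y)).
apply: eq_bigr => i _; rewrite qextU /= gt antiext_wd (qlinear_sum _ _ _ fl).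
by congr (_ * _); apply: eq_bigr => p _; rewrite (qlinearZ _ _ fl).
Qed.

End Substitution.

Definition sigma_letter (c : letter) : seq (rat * letter) :=
  [:: (1, if c is xa then xb else xa)].

Definition tau_letter (c : letter) : seq (rat * letter) :=
  if c is xa then [:: (1, xa); (1, xb)] else [:: (-1, xa)].

Lemma square_twist h : square h = twist sigma_letter h.
Proof.
rewrite /square /sigma (_ : (fun c => _) = lettersum sigma_letter) //.
by apply/funext => -[]; rewrite /lettersum big_seq1 scale1r.
Qed.

Lemma nabla_twist h : nabla h = twist tau_letter h.
Proof.
rewrite /nabla /tau (_ : (fun c => _) = lettersum tau_letter) //.
apply/funext => -[].
  by rewrite /lettersum big_cons big_seq1 /= !scale1r.
by rewrite /lettersum big_seq1 /= scaleN1r.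
Qed.

(** * Generators of H *)

Section Insertion.
Implicit Types (u v w : word) (c : letter).

(* The insertions of c in w elsewhere than in front. *)
Definition insertions c w : seq word := behead (interleavings [:: c] w).

Lemma interleavings_insertions c w :
  interleavings [:: c] w = (c :: w) :: insertions c w.
Proof. by case: w. Qed.

(** The m + 1 ways to place c inside or around the leading block c^m give the same word; the others
    insert it further inside w. *)
Lemma shsum_insertions (V : zmodType) c m w (G : word -> V) :
  shsum [:: c] (nseq m c ++ w) G =
  G (nseq m.+1 c ++ w) *+ m.+1 + \sum_(v <- insertions c w) G (nseq m c ++ v).
Proof.
elim: m G => [|m IHm] G.
  by rewrite /shsum interleavings_insertions big_cons.
by rewrite /= shsum_cons shsum0s IHm /= [in RHS]mulrS -addrA.
Qed.

Lemma insertions_head c w v x :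
  v \in insertions c w -> (w != [::]) && (head x v == head x w).
Proof. by case: w => [|d w] //= /mapP[y _ ->] /=; rewrite eqxx. Qed.

Lemma insertions_last c w v x : v \in insertions c w ->
  last x v = c \/ last x v = last x w.
Proof.
have mem y : v \in insertions c y -> v \in interleavings [:: c] y.
  by rewrite interleavings_insertions inE orbC => ->.
move=> /mem {mem}; elim: w x v => [|d w IHw] x v /=.
  by rewrite inE => /eqP ->; left.
rewrite inE => /orP[/eqP -> /=|/mapP[y yw ->]]; first by right.
exact: (IHw d y yw).
Qed.

Lemma last_rev x w : last x (rev w) = head x w.
Proof. by case: w => // y w; rewrite rev_cons last_rcons. Qed.

Lemma interleavings_Wp u v w :
  Wp u -> Wp v -> w \in interleavings u v -> Wp w.
Proof.
case: u v => [|c u] [|d v] Hu Hv; rewrite /= ?inE.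
- by move=> /eqP ->.
- by move=> /eqP ->.
- by move=> /eqP ->.
by rewrite mem_cat => /orP[] /mapP[y _ ->].
Qed.

(** Transfers to trailing letters what is known about leading ones. *)
Lemma shsum_rev (V : zmodType) u v (G : word -> V) :
  shsum u v G = shsum (rev u) (rev v) (G \o rev).
Proof.
elim: u v G => [|c u IHu] v G; first by rewrite !shsum0s /= revK.
elim: v G => [|d v IHv] G; first by rewrite !shsums0 /= revK.
rewrite !rev_cons shsum_rcons shsum_cons IHu IHv !rev_cons.
by congr (_ + _); apply: eq_shsum => w /=; rewrite rev_rcons.
Qed.

Lemma word_nseq_b w : exists m v, w = nseq m xb ++ v /\ Wp v.
Proof.
elim: w => [|c w [m [v [-> vp]]]]; first by exists 0%N, [::].
case: c; last by exists m.+1, v.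
by exists 0%N, (xa :: nseq m xb ++ v).
Qed.

Lemma word_nseq_a w : exists m v, w = v ++ nseq m xa /\ last xb v != xa.
Proof.
elim/last_ind: w => [|w c [m [v [-> vp]]]]; first by exists 0%N, [::].
case: c; last by exists 0%N, (rcons (v ++ nseq m xa) xb); rewrite cats0 last_rcons.
exists m.+1, v; split=> //; rewrite -cats1 -catA; congr (_ ++ _).
by elim: m => //= m ->.
Qed.

End Insertion.

Section Generation.
Variable P : H -> Prop.
Hypothesis P0 : P 0.
Hypothesis PL : forall (q : rat) x y, P x -> P y -> P (q *: x + y).

Lemma generation_sum (I : eqType) (s : seq I) (g : I -> H) :
  (forall i, i \in s -> P (g i)) -> P (\sum_(i <- s) g i).
Proof.
elim: s => [|i s IHs] Ps; first by rewrite big_nil.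
rewrite big_cons -[g i]scale1r; apply: PL; first by apply: Ps; rewrite inE eqxx.
by apply: IHs => j js; apply: Ps; rewrite inE js orbT.
Qed.

Lemma generation_word : (forall w, P (wd w)) -> forall x, P x.
Proof.
move=> Pw x; rewrite (malg_sum x); apply: generation_sum => w _.
by rewrite -[_ *: _]addr0; apply: PL => //; exact: Pw.
Qed.

(** Meant for a product y whose expansion contains x with multiplicity m + 1; solving for x divides
    by m + 1, hence the rational coefficients. *)
Lemma generation_step m x y :
  P y -> P (y - x *+ m.+1) -> P x.
Proof.
move=> Py Pyx; have -> : x = (- (m.+1%:R)^-1) *: (y - x *+ m.+1) + ((m.+1%:R)^-1) *: y.
  rewrite scaleNr scalerBr opprB subrK -scaler_nat scalerA mulVf ?scale1r //.
by apply: (PL _ Pyx); rewrite -[_ *: y]addr0; apply: PL.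
Qed.

(* b * (b^m w) = (m+1) b^(m+1) w + words with exactly m leading letters b. *)
Lemma generation_Wp :
  (forall w, Wp w -> P (wd w)) ->
  (forall y, P y -> P (shuffle (wd [:: xb]) y)) ->
  forall x, P x.
Proof.
move=> Pw Pb; apply: generation_word => w.
have [m [v [-> vp]]] := word_nseq_b w.
elim: m v vp => [|m IHm] v vp; first exact: Pw.
apply: (generation_step (m := m) (Pb _ (IHm v vp))).
rewrite shuffle_wd shsum_insertions addrAC subrr add0r.
apply: generation_sum => y yv; apply: IHm; rewrite /Wp.
by have /andP[_ /eqP ->] := insertions_head xa yv.
Qed.

(** The mirror image of the previous argument: trailing letters a are removed by multiplying v a^m
    by a, on reversed words. The extra point is that the words produced must stay in Wp. *)
Lemma generation_Wpp :
  (forall w, Wpp w -> P (wd w)) ->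
  (forall y, P y -> P (shuffle (wd [:: xa]) y)) ->
  (forall y, P y -> P (shuffle (wd [:: xb]) y)) ->
  forall x, P x.
Proof.
move=> Pw Pa Pb; apply: generation_Wp => // w.
have [m [v [-> vb]]] := word_nseq_a w.
elim: m v vb => [|m IHm] v vb vm.
  by move: vm; rewrite cats0 => vm; apply: Pw; rewrite /Wpp vb andbT.
have vm' : Wp (v ++ nseq m xa).
  by move: vm; case: (v) => //; case: (m).
apply: (generation_step (m := m) (Pa _ (IHm v vb vm'))).
have nr k : rev (nseq k xa) = nseq k xa.
  by elim: k => //= k IHk; rewrite rev_cons IHk -cats1; elim: k {IHk} => //= k ->.
have e k (y : word) : rev (nseq k xa ++ y) = rev y ++ nseq k xa by rewrite rev_cat nr.
rewrite shuffle_wd shsum_rev rev_cat nr shsum_insertions.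
rewrite [_ (nseq m.+1 _ ++ _)]/= (e m.+1 (rev v)) revK addrAC subrr add0r.
apply: generation_sum => y yv; rewrite /= e.
have /andP[v0 /eqP yb] := insertions_head xb yv.
have yn : head xb y != xa.
  by rewrite yb; move: vb; rewrite -{1}(revK v) last_rev.
apply: IHm; first by rewrite last_rev.
(* The last letter of [y] is the first of the reversed word. It is either the inserted a or the
   first letter of v, which is a because v is nonempty and begins a word of Wp. *)
have va : last xa y = xa.
  have [//|->] := insertions_last xa yv.
  move: vm v0; case: (v) => [|[] ? ?] //.
  by rewrite last_rev.
have : head xa (rev y) = xa.
  by rewrite -(revK y) last_rev in va.
by rewrite /Wp; case: (rev y) => [_|c z /= -> //]; case: (m).
Qed.

End Generation.

(** * Extension of a morphism from the span of Wp to H *)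

Section Extension.
Variables (F : numFieldType) (phi : word -> F) (beta : F).
Hypothesis phi1 : phi [::] = 1.
Hypothesis phiM : forall u v, Wp u -> Wp v -> shsum u v phi = phi u * phi v.

(* ext_b m w, the value at b^m w, is forced by multiplicativity at b * (b^(m-1) w). *)
Fixpoint ext_b m (w : word) : F :=
  if m is m'.+1 then
    (beta * ext_b m' w - \sum_(v <- insertions xb w) ext_b m' v) / m%:R
  else phi w.

Fixpoint lead_b (w : word) : nat :=
  if w is xb :: w' then (lead_b w').+1 else 0.

Definition ext_word w := ext_b (lead_b w) (drop (lead_b w) w).

Lemma ext_wordE m w : Wp w -> ext_word (nseq m xb ++ w) = ext_b m w.
Proof.
move=> ww; have E : lead_b (nseq m xb ++ w) = m.
  by elim: m => [|m /= ->] //; case: w ww => [|[]].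
by rewrite /ext_word E drop_cat size_nseq ltnn subnn drop0.
Qed.

Lemma ext_word_b w : shsum [:: xb] w ext_word = beta * ext_word w.
Proof.
have [m [v [-> vp]]] := word_nseq_b w.
rewrite shsum_insertions !ext_wordE //.
rewrite (eq_big_seq (fun y => ext_b m y)) => [|y yv]; last first.
  rewrite ext_wordE // /Wp.
  by have /andP[_ /eqP ->] := insertions_head xa yv.
by rewrite /= -[X in X + _]mulr_natr divfK ?subrK // pnatr_eq0.
Qed.

(** Both sides are linear in x, and by associativity and [ext_word_b] the identity passes from x to
    its product with b; Wp and b generate H. *)
Lemma ext_word_step (y : word) :
  (forall x, Wp x -> shsum x y ext_word = ext_word x * ext_word y) ->
  forall x, shsum x y ext_word = ext_word x * ext_word y.
Proof.
move=> Wy; set g := fun u => shsum u y ext_word.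
suff E x : qext g x = qext ext_word x * ext_word y.
  by move=> x; move: (E (wd x)); rewrite !qextU.
have bE (h : word -> F) z :
    qext h (shuffle (wd [:: xb]) z) = qext (fun v => shsum [:: xb] v h) z.
  rewrite (qlinear_shuffle _ _ (qext_qlinear h)) qextU.
  by apply: eq_qext => v; apply: eq_shsum => w /=; rewrite qextU.
have scE (h : word -> F) z : qext (fun v => beta * h v) z = beta * qext h z.
  by rewrite /qext mulr_sumr; apply: eq_bigr => k _; rewrite mulrCA.
move: x; apply: generation_Wp => [|q x z Ex Ez|w /Wy|z Ez].
- by rewrite !(qlinear0 (qext_qlinear _)) mul0r.
- by rewrite !qext_qlinear mulrDl Ex Ez mulrA.
- by rewrite !qextU.
rewrite !bE (eq_qext z ext_word_b) scE -mulrA -Ez -scE.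
apply: eq_qext => v; rewrite shsumA (eq_shsum _ _ ext_word_b) /shsum mulr_sumr.
exact: eq_bigr.
Qed.

Lemma ext_word_morphism : word_morphism ext_word.
Proof.
have E w : Wp w -> ext_word w = phi w by move=> wp; exact: (ext_wordE 0 wp).
split=> [|u v]; first by rewrite E.
(* One argument at a time is reduced to Wp, commutativity exchanging them in between. *)
move: u; apply: ext_word_step => u up; rewrite shsumC mulrC.
move: v; apply: ext_word_step => v vp; rewrite !E // -phiM // /shsum.
by apply: eq_big_seq => w /(interleavings_Wp vp up); exact: E.
Qed.

Lemma morphism_extension : exists f : H -> F,
  [/\ alg_morphism f, forall w, Wp w -> f (wd w) = phi w & f (wd [:: xb]) = beta].
Proof.
exists (qext ext_word); split; first exact/qext_morphism/ext_word_morphism.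
  by move=> w wp; rewrite qextU; exact: (ext_wordE 0 wp).
by rewrite qextU (ext_wordE (w := [::]) 1) //= big_nil phi1 subr0 divr1 mulr1.
Qed.
End Extension.

Lemma alg_morphism_Wpp_inj (F : numFieldType) (f g : H -> F) :
  alg_morphism f -> alg_morphism g ->
  (forall w, Wpp w -> f (wd w) = g (wd w)) ->
  f (wd [:: xa]) = g (wd [:: xa]) -> f (wd [:: xb]) = g (wd [:: xb]) ->
  f =1 g.
Proof.
move=> [f1 fl fM] [g1 gl gM] fgw fga fgb; apply: generation_Wpp => //.
- by rewrite !qlinear0.
- by move=> q x y Ex Ey; rewrite fl gl Ex Ey.
- by move=> y Ey; rewrite fM gM fga Ey.
- by move=> y Ey; rewrite fM gM fgb Ey.
Qed.

Import ComplexField.Normc.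
Local Open Scope classical_set_scope.
Local Open Scope complex_scope.

(** * Complex limits and series *)

Section ComplexBasics.
Variable R : realType.
Notation C := (R[i])^o.
Implicit Types (z : C).

Lemma normC_normc z : `|z| = (normc z)%:C.
Proof. by []. Qed.

Lemma normcD z1 z2 : normc (z1 + z2) <= normc z1 + normc z2.
Proof. exact: le_normcD. Qed.

Lemma normc_ge0 z : 0 <= normc z.
Proof. by rewrite -ler0c -normC_normc normr_ge0. Qed.

Lemma normc_real (x : R) : normc x%:C = `|x|.
Proof. by rewrite /normc /= expr0n addr0 sqrtr_sqr. Qed.

Lemma normc_distC z1 z2 : normc (z1 - z2) = normc (z2 - z1).
Proof. by rewrite -normcN opprB. Qed.

Lemma normcB z1 z2 : normc (z1 - z2) <= normc z1 + normc z2.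
Proof. by rewrite -(normcN z2) normcD. Qed.

Lemma normcX z n : normc (z ^+ n) = normc z ^+ n.
Proof. by elim: n => [|n IHn]; rewrite ?expr0 ?normc1 // !exprS normcM IHn. Qed.

Lemma normc_sum (I : Type) (s : seq I) (P : pred I) (u : I -> C) :
  normc (\sum_(i <- s | P i) u i) <= \sum_(i <- s | P i) normc (u i).
Proof.
elim/big_rec2: _ => [|i y x _ yx]; first by rewrite normc0.
by apply: le_trans (normcD _ _) _; rewrite lerD2l.
Qed.

Lemma normc_Re z : `|complex.Re z| <= normc z.
Proof.
by case: z => x y; rewrite -sqrtr_sqr /= ler_wsqrtr // lerDl sqr_ge0.
Qed.

Lemma normc_Im z : `|complex.Im z| <= normc z.
Proof.
by case: z => x y; rewrite -sqrtr_sqr /= ler_wsqrtr // lerDr sqr_ge0.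
Qed.

Lemma ReB z1 z2 : complex.Re (z1 - z2) = complex.Re z1 - complex.Re z2.
Proof. by case: z1 z2 => ? ? []. Qed.

Lemma ImB z1 z2 : complex.Im (z1 - z2) = complex.Im z1 - complex.Im z2.
Proof. by case: z1 z2 => ? ? []. Qed.

Lemma normc_le z : normc z <= `|complex.Re z| + `|complex.Im z|.
Proof.
rewrite {1}[z]complexE; apply: le_trans (normcD _ _) _.
by rewrite normcM !normc_real /= expr0n expr1n add0r sqrtr1 mul1r.
Qed.

Lemma ccvgP (T : Type) (F : set_system T) {FF : Filter F} (f : T -> C) (l : C) :
  f @ F --> l <-> forall e : R, 0 < e -> \forall x \near F, normc (l - f x) < e.
Proof.
split=> [/cvgrPdist_lt fl e e0|fl].
  have := fl e%:C; rewrite ltcR => /(_ e0).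
  by apply: filterS => x; rewrite normC_normc ltcR.
apply/cvgrPdist_lt => e e0.
(* In the partial order of R[i] a positive number is real. *)
have er : e = (complex.Re e)%:C by apply/esym/RRe_real/gtr0_real.
move: e0; rewrite er ltcR => /fl; apply: filterS => x.
by rewrite normC_normc ltcR.
Qed.

Lemma cvg_complex (T : Type) (F : set_system T) {FF : Filter F} (f : T -> C) (l : C) :
  (fun x => complex.Re (f x)) @ F --> complex.Re l ->
  (fun x => complex.Im (f x)) @ F --> complex.Im l -> f @ F --> l.
Proof.
move=> fr fi; apply/ccvgP => e e0; have e2 : 0 < e / 2 by rewrite divr_gt0.
move/cvgrPdist_lt: fr => /(_ _ e2) fr; move/cvgrPdist_lt: fi => /(_ _ e2) fi.
near=> x; apply: le_lt_trans (normc_le _) _; rewrite (splitr e).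
rewrite ReB ImB.
by apply: ltrD; near: x.
Unshelve. all: by end_near. Qed.

Lemma cvg_Re (T : Type) (F : set_system T) {FF : Filter F} (f : T -> C) (l : C) :
  f @ F --> l -> (fun x => complex.Re (f x)) @ F --> complex.Re l.
Proof.
move=> /ccvgP fl; apply/cvgrPdist_lt => e /fl; apply: filterS => x.
apply: le_lt_trans; apply: le_trans (normc_Re _).
by rewrite ReB.
Qed.

Definition csum (u : nat -> C) : C := limn (series u).

Lemma cvg_csum (u : nat -> C) (b : nat -> R) :
  cvgn (series b) -> (forall n, normc (u n) <= b n) ->
  series u @ \oo --> csum u.
Proof.
move=> bc ub.
have rc (p : C -> R) : (forall z, `|p z| <= normc z) -> cvgn (series (p \o u)).
  move=> pn; apply: normed_cvg; apply: (series_le_cvg (v_ := b)) => // n.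
  - exact: normr_ge0.
  - exact: le_trans (normc_ge0 _) (ub n).
  - exact: le_trans (pn _) (ub n).
have /cvg_ex[x xr] := rc _ normc_Re; have /cvg_ex[y yi] := rc _ normc_Im.
suff : series u @ \oo --> (Complex x y : C) by move/cvgP.
have Es n : series u n =
    Complex (series (@complex.Re R \o u) n) (series (@complex.Im R \o u) n).
  elim: n => [|n IHn]; first by rewrite /series /= !big_geq.
  rewrite !seriesSr IHn /=; by case: (u n).
apply: cvg_complex => /=.
  by under eq_fun do rewrite Es /=.
by under eq_fun do rewrite Es /=.
Qed.

Lemma csum_tail (u : nat -> C) (b : nat -> R) N :
  cvgn (series b) -> (forall n, normc (u n) <= b n) ->
  normc (csum u - series u N) <= limn (series b) - series b N.
Proof.
move=> bc ub; have uc := cvg_csum bc ub.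
apply/ler_addgt0Pr => e e0; move/ccvgP: uc => /(_ e e0) uc.
have b0 n : 0 <= b n by apply: le_trans (ub n); exact: normc_ge0.
near \oo => M; have NM : (N <= M)%N by near: M; exact: nbhs_infty_ge.
rewrite -(subrK (series u M) (csum u)) -addrA; apply: le_trans (normcD _ _) _.
rewrite [leLHS]addrC; apply: lerD; last by apply/ltW; near: M.
rewrite sub_series NM; apply: le_trans (normc_sum _ _ _) _.
apply: (@le_trans _ _ (series b M - series b N)).
  by rewrite sub_series NM; apply: ler_sum => n _.
rewrite lerD2r; apply: nondecreasing_cvgn_le => //.
by apply: nondecreasing_series => n _ _.
Unshelve. all: by end_near. Qed.

Lemma cvg_series_fin (T : Type) (F : set_system T) {FF : Filter F}
    (g : nat -> T -> C) (l : nat -> C) N :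
  (forall n, g n x @[x --> F] --> l n) ->
  series (g ^~ x) N @[x --> F] --> series l N.
Proof.
move=> gl; elim: N => [|N IHN].
  by rewrite /series /= big_geq //; under eq_fun do rewrite big_geq //; exact: cvg_cst.
rewrite seriesSr; under eq_fun do rewrite seriesSr.
exact: (cvgD IHN (gl N)).
Qed.

(** Dominated convergence for series along an arbitrary filter. It gives both termwise
    differentiation inside the disc and continuity up to the circle. *)
Lemma tannery (T : Type) (F : set_system T) {FF : Filter F}
    (g : nat -> T -> C) (l : nat -> C) (b : nat -> R) :
  cvgn (series b) -> (forall n, g n x @[x --> F] --> l n) ->
  (forall n, normc (l n) <= b n) ->
  (\forall x \near F, forall n, normc (g n x) <= b n) ->
  csum (g ^~ x) @[x --> F] --> csum l.
Proof.
move=> bc gl lb gb; apply/ccvgP => e e0; have e3 : 0 < e / 3 by rewrite divr_gt0.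
move/cvgrPdist_lt: (bc) => /(_ _ e3)[N _ /(_ N (leqnn N)) bN].
have {bN} bN : limn (series b) - series b N < e / 3 by apply: le_lt_trans bN; exact: ler_norm.
have /ccvgP/(_ _ e3) gN := @cvg_series_fin T F FF g l N gl.
near=> x.
have xb : forall n, normc (g n x) <= b n by near: x.
have xN : normc (series l N - series (g ^~ x) N) < e / 3 by near: x.
have E (a s a' s' : C) : a - a' = (a - s) + (s - s') - (a' - s').
  by rewrite addrA subrK opprB addrA subrK.
rewrite (E _ (series l N) _ (series (g ^~ x) N)).
apply: le_lt_trans (normcB _ _) _; apply: le_lt_trans (lerD (normcD _ _) (lexx _)) _.
have := csum_tail N bc lb; have := csum_tail N bc xb; lra.
Unshelve. all: by end_near. Qed.

End ComplexBasics.

(** * Coefficients of polylogarithms *)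

Section Coefficients.
Variable R : realType.
Implicit Types (u v w : word) (n : nat).

(** Recursion on the reversed word, because integration acts at the last letter: appending a
    integrates L_w(z)/(1 - z), whence the partial sums, and appending b integrates L_w(z)/z. *)
Fixpoint rcoef w n : R :=
  if w is c :: w' then
    (if c is xa then \sum_(m < n) rcoef w' m else rcoef w' n) / n%:R
  else (n == 0%N)%:R.

(* The coefficient of z^n in the power series of L_w; meaningful for w in Wp
   only. Since x / 0 = 0, it vanishes at n = 0 unless w is empty. *)
Definition lcoef w := rcoef (rev w).

Lemma lcoef_nil n : lcoef [::] n = (n == 0%N)%:R.
Proof. by []. Qed.

Lemma lcoef_a w n : lcoef (rcons w xa) n = (\sum_(m < n) lcoef w m) / n%:R.
Proof. by rewrite /lcoef rev_rcons. Qed.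

Lemma lcoef_b w n : lcoef (rcons w xb) n = lcoef w n / n%:R.
Proof. by rewrite /lcoef rev_rcons. Qed.

Lemma lcoef0 w c : lcoef (rcons w c) 0 = 0.
Proof. by case: c; rewrite ?lcoef_a ?lcoef_b invr0 mulr0. Qed.

Lemma lcoef_ge0 w n : 0 <= lcoef w n.
Proof.
elim/last_ind: w n => [|w [] IHw] n; first by rewrite lcoef_nil ler0n.
  by rewrite lcoef_a divr_ge0 // sumr_ge0.
by rewrite lcoef_b divr_ge0.
Qed.

Lemma lcoef_le1 w n : lcoef w n <= 1.
Proof.
elim/last_ind: w n => [|w [] IHw] n; first by rewrite lcoef_nil lern1 leq_b1.
  case: n => [|n]; first by rewrite lcoef0.
  rewrite lcoef_a ler_pdivrMr ?ltr0n // mul1r.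
  apply: (@le_trans _ _ (\sum_(m < n.+1) 1)); first by apply: ler_sum => m _.
  by rewrite sumr_const card_ord.
case: n => [|n]; first by rewrite lcoef0.
rewrite lcoef_b ler_pdivrMr ?ltr0n // mul1r.
by apply: le_trans (IHw _) _; rewrite ler1n.
Qed.

(** The weight n^(-1/2), equal to 0 at n = 0. The coefficients decay like powers of log n over n;
    this weaker rate needs no logarithm, is preserved by both steps of the recursion, and is still
    summable once divided by n. *)
Definition isqrt n : R := (Num.sqrt n%:R)^-1.

Lemma isqrt_ge0 n : 0 <= isqrt n.
Proof. by rewrite invr_ge0 sqrtr_ge0. Qed.

(** Turns two consecutive square roots into unknowns with polynomial relations, as the arithmetic
    tactics require. *)
Lemma sqrtS n : exists s t : R, [/\ Num.sqrt n.+1%:R = s, Num.sqrt n.+2%:R = t,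
  1 <= s < t, s ^+ 2 = n.+1%:R & t ^+ 2 = s ^+ 2 + 1].
Proof.
exists (Num.sqrt n.+1%:R), (Num.sqrt n.+2%:R); split=> //.
- apply/andP; split; last by rewrite ltr_sqrt ?ltr0n // ltr_nat.
  by rewrite -[leLHS]sqrtr1 ler_wsqrtr // ler1n.
- by rewrite sqr_sqrtr.
- by rewrite !sqr_sqrtr // -natr1.
Qed.

Lemma sum_isqrt n : \sum_(m < n) isqrt m <= 2 * Num.sqrt n%:R.
Proof.
case: n => [|n]; first by rewrite big_ord0 sqrtr0 mulr0.
apply: (@le_trans _ _ (2 * Num.sqrt n%:R)); last first.
  by rewrite ler_pM2l // ler_wsqrtr // ler_nat.
elim: n => [|[|n] IHn].
- by rewrite big_ord_recr big_ord0 /= /isqrt sqrtr0 invr0 mulr0 addr0.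
- by rewrite !big_ord_recr big_ord0 /= /isqrt sqrtr0 invr0 !add0r sqrtr1 invr1 mulr1 ler1n.
rewrite big_ord_recr /=; apply: le_trans (lerD IHn (lexx _)) _.
rewrite /isqrt; have [s [t [-> -> /andP[s1 st] sn ts]]] := sqrtS n.
(* Since t^2 - s^2 = 1, t - s = 1/(t + s), which is at least 1/(2 t). *)
suff : t^-1 <= 2 * (t - s) by lra.
by rewrite -[leLHS]mul1r ler_pdivrMr; nra.
Qed.

Lemma isqrt_divn n : isqrt n / n%:R = Num.sqrt n%:R * (n%:R ^+ 2)^-1.
Proof.
rewrite /isqrt; set s := Num.sqrt _.
have -> : n%:R = s ^+ 2 :> R by rewrite sqr_sqrtr.
have [->|s0] := eqVneq s 0; first by rewrite invr0 !mul0r.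
by field.
Qed.

Lemma cvg_isqrt_divn : cvgn (series (fun n => isqrt n / n%:R)).
Proof.
apply: nondecreasing_is_cvgn.
  by apply: nondecreasing_series => n _ _; rewrite divr_ge0 ?isqrt_ge0.
exists 4 => _ [n _ <-].
(* A telescoping majorant. With s, t the square roots of n + 1, n + 2, the step is s^-3 <= 4 (1/s -
   1/t), that is t (t + s) <= 4 s^2; the left side is at most (2 + sqrt 2) s^2, with equality at s =
   1. *)
suff : series (fun n => isqrt n / n%:R) n.+1 <= 4 * (1 - isqrt n.+1).
  have i0 := isqrt_ge0 n.+1; move=> h; apply: (@le_trans _ _ (4 * (1 - isqrt n.+1))); last by lra.
  apply: le_trans h; rewrite seriesSr lerDl; by rewrite divr_ge0 ?isqrt_ge0.
elim: n => [|n IHn].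
  by rewrite seriesSr /series /= big_geq // invr0 mulr0 addr0 /isqrt sqrtr1 invr1 subrr mulr0.
rewrite seriesSr; apply: le_trans (lerD IHn (lexx _)) _.
rewrite isqrt_divn /isqrt; have [s [t [-> -> /andP[s1 st] <- ts]]] := sqrtS n.
have t2s : t <= 2 * s by nra.
have st1 : (t - s) * (t + s) = 1 by rewrite -subr_sqr ts; lra.
suff : s * (s ^+ 2 ^+ 2)^-1 <= 4 * (s^-1 - t^-1) by lra.
have -> : s * (s ^+ 2 ^+ 2)^-1 = t * (s ^+ 3 * t)^-1.
  by field; apply/andP; split; rewrite gt_eqF //; lra.
have -> : 4 * (s^-1 - t^-1) = (4 * s ^+ 2 * (t - s)) * (s ^+ 3 * t)^-1.
  by field; apply/andP; split; rewrite gt_eqF //; lra.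
rewrite ler_pM2r; last by rewrite invr_gt0 mulr_gt0 ?exprn_gt0; lra.
rewrite -[leLHS]mulr1 -st1 [leLHS](_ : _ = t * (t + s) * (t - s)); last by ring.
rewrite ler_pM2r; nra.
Qed.

Lemma cvg_isqrt : isqrt n @[n --> \oo] --> 0.
Proof.
apply/cvgrPdist_lt => e e0.
exists (Num.trunc (e^-1 ^+ 2)).+1 => // n /= en.
have {}en : e^-1 ^+ 2 < n%:R.
  by apply: lt_le_trans (truncnS_gt _) _; rewrite ler_nat.
have n0 : (0 < n)%N by rewrite -(ltr_nat R); apply: le_lt_trans en; rewrite sqr_ge0.
rewrite sub0r normrN ger0_norm ?isqrt_ge0 //.
rewrite invf_plt ?posrE ?sqrtr_gt0 ?ltr0n //.
rewrite -(ltr_pXn2r (n := 2)) ?nnegrE ?sqrtr_ge0 ?invr_ge0 ?ltW //.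
by rewrite sqr_sqrtr.
Qed.

(** The partial sums of n^(-1/2) are at most 2 sqrt n, so dividing them by n restores the rate
    n^(-1/2). The term at n = 0 accounts for the empty word and adds 1 to the partial sums, whence
    the constant K * 2 + 1. *)
Lemma lcoef_isqrt w : exists K, 0 <= K /\
  forall n, lcoef w n <= K * isqrt n + (n == 0%N)%:R.
Proof.
elim/last_ind: w => [|w [] [K [K0 IHw]]].
- by exists 0; split=> // n; rewrite mul0r add0r.
- exists (K * 2 + 1); split; first by rewrite addr_ge0 // mulr_ge0.
  case=> [|n]; first by rewrite lcoef0 addr_ge0 // mulr_ge0 ?isqrt_ge0 ?addr_ge0 ?mulr_ge0.
  rewrite lcoef_a addr0.
  apply: (@le_trans _ _ ((K * (2 * Num.sqrt n.+1%:R) + 1) / n.+1%:R)).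
    rewrite ler_pM2r ?invr_gt0 ?ltr0n //.
    apply: (@le_trans _ _ (\sum_(m < n.+1) (K * isqrt m + (m == 0%N :> nat)%:R))).
      by apply: ler_sum => m _.
    rewrite big_split /= -mulr_sumr lerD ?ler_wpM2l ?sum_isqrt //.
    by rewrite big_ord_recl /= big1 ?addr0.
  rewrite /isqrt; have [s [t [-> _ /andP[s1 _] <- _]]] := sqrtS n.
  have -> : (K * 2 + 1) * s^-1 = ((K * 2 + 1) * s) / s ^+ 2 by field; rewrite gt_eqF //; lra.
  by rewrite ler_pM2r ?invr_gt0 ?exprn_gt0; nra.
exists K; split=> // n; case: n => [|n].
  by rewrite lcoef0 addr_ge0 // mulr_ge0 ?isqrt_ge0.
rewrite lcoef_b addr0 ler_pdivrMr ?ltr0n //.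
apply: le_trans (IHw _) _; rewrite addr0 ler_peMr ?mulr_ge0 ?isqrt_ge0 //.
by rewrite ler1n.
Qed.

Lemma cvg_coef w : lcoef w n @[n --> \oo] --> 0.
Proof.
have [K [K0 wK]] := lcoef_isqrt w.
have Kc : (fun n => K * isqrt n) @ \oo --> 0.
  by rewrite -(mulr0 K); exact: (cvgM (cvg_cst K) cvg_isqrt).
apply: (squeeze_cvgr _ (cvg_cst 0) Kc).
exists 1%N => // n /= n0; rewrite lcoef_ge0; apply: le_trans (wK n) _.
by rewrite eqn0Ngt n0 addr0.
Qed.

Lemma cvg_series_coef_b w : cvgn (series (lcoef (rcons w xb))).
Proof.
have [K [K0 wK]] := lcoef_isqrt w.
apply: (series_le_cvg (v_ := K *: (fun n => isqrt n / n%:R))).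
- by move=> n; exact: lcoef_ge0.
- by move=> n; rewrite mulr_ge0 // divr_ge0 ?isqrt_ge0.
- move=> n; rewrite lcoef_b [leRHS]mulrA; case: n => [|n]; first by rewrite invr0 !mulr0.
  by rewrite ler_pM2r ?invr_gt0 ?ltr0n //; have := wK n.+1; rewrite addr0.
- by apply: is_cvg_seriesZ; exact: cvg_isqrt_divn.
Qed.

(* The coefficients of (1 - z) L_w(z); unlike those of L_w they are summable,
   which gives continuity on the closed disc, and the value 0 at z = 1. *)
Definition dcoef w n := lcoef w n - (if n is n'.+1 then lcoef w n' else 0).

Lemma series_dcoef w n : series (dcoef w) n.+1 = lcoef w n.
Proof.
elim: n => [|n IHn]; rewrite seriesSr ?IHn /dcoef ?subr0.
  by rewrite /series /= big_geq ?add0r.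
by rewrite addrC subrK.
Qed.

Lemma cvg_shift (u : R ^nat) : cvgn (series u) -> cvgn (series (fun n => u n.+1)).
Proof.
move=> uc; have -> : series (fun n => u n.+1) = (fun n => series u n.+1 - u 0%N).
  by apply/funext => n; rewrite /series /= [X in _ = X - _]big_nat_recl // addrC addKr.
apply: is_cvgB; last exact: is_cvg_cst.
by apply/cvg_ex; case/cvg_ex: uc => l ul; exists l; move: ul; rewrite -(cvg_shiftS (series u)).
Qed.

Lemma cvg_unshift (u : R ^nat) : cvgn (series (fun n => u n.+1)) -> cvgn (series u).
Proof.
move=> uc; have E : (fun n => series u n.+1) = (fun n => u 0%N + series (fun n => u n.+1) n).
  by apply/funext => n; rewrite /series /= [LHS]big_nat_recl.
have : cvgn (fun n => series u n.+1).
  by rewrite E; apply: is_cvgD => //; exact: is_cvg_cst.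
by case/cvg_ex => l ul; apply/cvg_ex; exists l; rewrite -(cvg_shiftS (series u)).
Qed.

(** For a word ending with b the coefficients themselves are summable. For w a, the recursion gives
    the difference at n + 1 as ([lcoef w n] - [lcoef (rcons w xa) n])/(n + 1), of order n^(-3/2). *)
Lemma cvg_series_dcoef w : cvgn (series (fun n => `|dcoef w n|)).
Proof.
have dn (u : R ^nat) : cvgn (series u) -> (forall n, `|dcoef w n.+1| <= u n) ->
    cvgn (series (fun n => `|dcoef w n|)).
  move=> uc du; apply: cvg_unshift; apply: (series_le_cvg (v_ := u)) => // n.
  exact: le_trans (normr_ge0 _) (du n).
have d0 : cvgn (series (fun n => ((n == 0%N)%:R : R))).
  apply: cvg_unshift; rewrite (_ : series _ = cst 0); first exact: is_cvg_cst.
  by apply/funext => n; rewrite /series /= big1.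
elim/last_ind: w dn => [|w c _] dn.
  apply: (dn _ d0) => n; rewrite /dcoef !lcoef_nil /= sub0r normrN.
  by rewrite ger0_norm // ler0n.
case: c dn => dn.
  have [K [K0 wK]] := lcoef_isqrt w; have [L [L0 wL]] := lcoef_isqrt (rcons w xa).
  have KLc : cvgn (series ((K + L) *: (fun n => isqrt n / n%:R) + 2 *: (fun n => (n == 0%N)%:R))).
    by apply: is_cvg_seriesD; apply: is_cvg_seriesZ => //; exact: cvg_isqrt_divn.
  apply: (dn _ KLc) => n.
  have -> : dcoef (rcons w xa) n.+1 = (lcoef w n - lcoef (rcons w xa) n) / n.+1%:R.
    rewrite /dcoef lcoef_a big_ord_recr /=.
    have -> : \sum_(i < n) lcoef w i = lcoef (rcons w xa) n * n%:R.
      case: n => [|n]; first by rewrite big_ord0 mulr0.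
      by rewrite lcoef_a divfK // pnatr_eq0.
    by rewrite -natr1; field; rewrite natr1 pnatr_eq0.
  rewrite normrM normfV (@ger0_norm _ n.+1%:R) //.
  have wa := wL n; have w0 := wK n.
  have wa0 := lcoef_ge0 (rcons w xa) n; have w00 := lcoef_ge0 w n.
  apply: (@le_trans _ _ (((K + L) * isqrt n + 2 * (n == 0%N)%:R) / n.+1%:R)).
    rewrite ler_pM2r ?invr_gt0 ?ltr0n // ler_norml; apply/andP; split; nra.
  change (((K + L) * isqrt n + 2 * (n == 0%N)%:R) / n.+1%:R <=
          (K + L) * (isqrt n / n%:R) + 2 * (n == 0%N)%:R).
  case: n {wa w0 wa0 w00} => [|n]; first by rewrite /isqrt sqrtr0 invr0 mul0r !mulr0 !add0r divr1.
  rewrite mulr0 !addr0 mulrA ler_wpM2l ?mulr_ge0 ?addr_ge0 ?isqrt_ge0 //.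
  by rewrite lef_pV2 ?posrE ?ltr0n // ler_nat.
have wb := @cvg_series_coef_b w; have wb' := cvg_shift wb.
apply: (dn _ (is_cvg_seriesD wb' wb)) => n.
apply: le_trans (ler_normB _ _) _.
by rewrite !ger0_norm ?lcoef_ge0.
Qed.

End Coefficients.

(** * Power series *)

Section PowerSeries.
Variable R : realType.
Notation C := (R[i])^o.
Implicit Types (z : C) (c : nat -> R) (w : word).

Lemma cvg_near_eq (T : Type) (F : set_system T) {FF : Filter F} (f g : T -> C) (l : C) :
  (\forall x \near F, f x = g x) -> f @ F --> l -> g @ F --> l.
Proof.
move=> fg /ccvgP fl; apply/ccvgP => e /fl.
by apply: filterS2 fg => x ->.
Qed.

Lemma is_deriveP (f : C -> C) (z l : C) :
  is_derive z (1 : C) f l <-> h^-1 * (f (z + h) - f z) @[h --> (0 : C)^'] --> l.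
Proof.
have E : (fun h : C => h^-1 *: ((f \o shift z) (h *: (1 : C)) - f z)) =
         (fun h : C => h^-1 * (f (z + h) - f z)).
  by apply/funext => h /=; rewrite -[h *: 1]/(h * 1) mulr1 (addrC h).
split=> [[df <-]|hl].
  by move: df; rewrite /derivable /derive E.
apply: DeriveDef; first by rewrite /derivable E; apply/cvg_ex; exists l.
by rewrite /derive E; apply/cvg_lim.
Qed.

Definition summable (u : nat -> C) :=
  exists b : nat -> R, cvgn (series b) /\ forall n, normc (u n) <= b n.

Lemma summable_cvg u : summable u -> series u @ \oo --> csum u.
Proof. by move=> [b [bc ub]]; exact: cvg_csum bc ub. Qed.

Lemma csumE u (l : C) : series u @ \oo --> l -> csum u = l.
Proof. exact: cvg_lim. Qed.

Lemma csum_linear (a : C) u v : summable u -> summable v ->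
  csum (fun n => a * u n + v n) = a * csum u + csum v.
Proof.
move=> /summable_cvg us /summable_cvg vs; apply: csumE.
have -> : series (fun n => a * u n + v n) = (fun n => a * series u n + series v n).
  by apply/funext => n; rewrite /series /= mulr_sumr big_split.
exact: (cvgD (cvgM (cvg_cst a) us) vs).
Qed.

Lemma summable_shift u : summable u -> summable (fun n => u n.+1).
Proof.
by move=> [b [bc ub]]; exists (fun n => b n.+1); split=> //; exact: cvg_shift.
Qed.

Lemma csum_shift u : summable u -> csum u = u 0%N + csum (fun n => u n.+1).
Proof.
move=> us; apply: csumE; have := summable_cvg (summable_shift us).
move=> /(cvgD (cvg_cst (u 0%N))) uc; rewrite -(cvg_shiftS (series u)).
suff -> : [sequence series u n.+1]_n = cst (u 0%N) + series (fun n => u n.+1) by [].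
by apply/funext => n; rewrite /series /= [LHS]big_nat_recl.
Qed.

Lemma summableZ (a : C) u : summable u -> summable (fun n => a * u n).
Proof.
move=> [b [bc ub]]; exists (normc a *: b); split; first exact: is_cvg_seriesZ.
by move=> n; rewrite normcM ler_wpM2l ?normc_ge0.
Qed.

Lemma csumZ (a : C) u : summable u -> csum (fun n => a * u n) = a * csum u.
Proof.
move=> /summable_cvg us; apply: csumE.
have -> : series (fun n => a * u n) = (fun n => a * series u n).
  by apply/funext => n; rewrite /series /= mulr_sumr.
exact: (cvgM (cvg_cst a) us).
Qed.

Definition pser c z : C := csum (fun n => (c n)%:C * z ^+ n).

Lemma summable_pser_le1 c z : cvgn (series (fun n => `|c n|)) -> normc z <= 1 ->
  summable (fun n => (c n)%:C * z ^+ n).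
Proof.
move=> cc z1; exists (fun n => `|c n|); split=> // n.
by rewrite normcM normc_real normcX ler_piMr // exprn_ile1 // normc_ge0.
Qed.

Lemma cvg_nX (r : R) : 0 <= r -> r < 1 ->
  cvgn (series (fun n => n%:R * r ^+ n.-1)).
Proof.
move=> r0 r1; apply: nondecreasing_is_cvgn.
  by apply: nondecreasing_series => n _ _; rewrite mulr_ge0 // exprn_ge0.
(* The value of the full sum, as the derivative of the geometric series. *)
exists ((1 - r) ^- 2) => _ [n _ <-].
have q0 : 0 < (1 - r) ^+ 2 by rewrite exprn_gt0 // subr_gt0.
apply: (@le_trans _ _ (series (fun n => n%:R * r ^+ n.-1) n.+1)).
  by rewrite seriesSr lerDl mulr_ge0 // exprn_ge0.
rewrite -[leRHS]mul1r ler_pdivlMr //.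
have -> : series (fun n => n%:R * r ^+ n.-1) n.+1 * (1 - r) ^+ 2 =
    1 - r ^+ n - n%:R * r ^+ n * (1 - r).
  elim: n => [|n IHn]; first by rewrite seriesSr /series /= big_geq //; ring.
  by rewrite seriesSr mulrDl IHn /= (exprS r n) -natr1; ring.
have rn : 0 <= r ^+ n by rewrite exprn_ge0.
have : 0 <= n%:R * r ^+ n * (1 - r) by rewrite !mulr_ge0 // subr_ge0 ltW.
by lra.
Qed.

Lemma summable_pser c z K : (forall n, `|c n| <= K) -> normc z < 1 ->
  summable (fun n => (c n)%:C * z ^+ n).
Proof.
move=> cK z1; exists (geometric K (normc z)); split.
  by apply: is_cvg_geometric_series; rewrite ger0_norm ?normc_ge0.
by move=> n; rewrite normcM normc_real normcX /= ler_wpM2r // exprn_ge0 ?normc_ge0.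
Qed.

Definition dpser c n : R := n.+1%:R * c n.+1.

Lemma summable_dpser c z K : (forall n, `|c n| <= K) -> normc z < 1 ->
  summable (fun n => (dpser c n)%:C * z ^+ n).
Proof.
move=> cK z1; have z0 := normc_ge0 z.
exists (fun n => K * (n.+1%:R * normc z ^+ n)); split.
  by apply: (is_cvg_seriesZ (k := K)); apply: (cvg_shift (cvg_nX z0 z1)).
move=> n; rewrite normcM normc_real normcX normrM mulrA ler_wpM2r ?exprn_ge0 //.
by rewrite normr_nat mulrC ler_wpM2r.
Qed.

(** Dominated convergence of the difference quotients: (x^n - y^n)/(x - y) is a sum of n monomials,
    each bounded by r^(n-1) when |x|, |y| <= r. *)
Lemma is_derive_pser c z K : (forall n, `|c n| <= K) -> normc z < 1 ->
  is_derive z (1 : C) (pser c) (pser (dpser c) z).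
Proof.
move=> cK z1; apply/is_deriveP; have z0 := normc_ge0 z.
pose g n (h : C) : C := h^-1 * ((c n)%:C * (z + h) ^+ n - (c n)%:C * z ^+ n).
pose l n : C := (c n)%:C * (n%:R * z ^+ n.-1).
(* The radius r = |z| + d lies midway between |z| and 1, and bounds |z + h| as soon as |h| < d. *)
pose d := (1 - normc z) / 2; have d0 : 0 < d by rewrite divr_gt0 // subr_gt0.
pose r := normc z + d; have r0 : 0 <= r by rewrite addr_ge0 // ltW.
have r1 : r < 1 by rewrite /r /d; lra.
have bc : cvgn (series (fun n => K * (n%:R * r ^+ n.-1))).
  by apply: (is_cvg_seriesZ (k := K)); exact: cvg_nX.
have K0 : 0 <= K by apply: le_trans (cK 0%N).
have zr : normc z <= r by rewrite /r lerDl ltW.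
have lb n : normc (l n) <= K * (n%:R * r ^+ n.-1).
  rewrite /l !normcM normc_real normcX.
  have -> : normc (n%:R : C) = n%:R by rewrite -(rmorph_nat (real_complex R)) normc_real normr_nat.
  by rewrite ler_pM ?mulr_ge0 ?exprn_ge0 // ler_wpM2l // lerXn2r ?nnegrE.
have lE : csum l = pser (dpser c) z.
  rewrite csum_shift /l /= ?mul0r ?mulr0 ?add0r.
    congr csum; apply/funext => n; rewrite /l /dpser rmorphM /= rmorph_nat mulrA.
    by rewrite (mulrC (c n.+1)%:C).
  by exists (fun n => K * (n%:R * r ^+ n.-1)).
rewrite -lE.
have hr : \forall h \near (0 : C)^', normc (z + h) <= r /\ h != 0.
  have dC : (0 : R[i]) < d%:C by rewrite -[0]/(0%:C) ltcR.
  exists d%:C; first exact: dC.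
  move=> h /=; rewrite sub0r normrN normC_normc ltcR => hd h0; split=> //.
  by apply: le_trans (normcD _ _) _; rewrite /r lerD2l ltW.
have gl n : g n h @[h --> (0 : C)^'] --> l n.
  apply/(is_deriveP (fun x => (c n)%:C * x ^+ n)).
  have := is_deriveZ (f := (@id C) ^+ n) (c n)%:C (is_deriveX n (is_derive_id z (1 : C))).
  have -> : (c n)%:C \*: (@id C) ^+ n = (fun x : C => (c n)%:C * x ^+ n).
    by apply/funext => x; rewrite /GRing.scale_fun /= fctE.
  move=> dX; apply: (is_derive_eq dX).
  by rewrite /l /= -[_ *: 1]/(_ * 1) mulr1.
have gb : \forall h \near (0 : C)^', forall n, normc (g n h) <= K * (n%:R * r ^+ n.-1).
  apply: filterS hr => h [zh h0] n.
  rewrite /g -mulrBr subrXX (addrC z) addrK mulrCA mulKf //.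
  rewrite normcM normc_real; apply: ler_pM; rewrite ?normc_ge0 //.
  apply: le_trans (normc_sum _ _ _) _.
  apply: (@le_trans _ _ (\sum_(i < n) r ^+ n.-1)); last first.
    by rewrite sumr_const card_ord -[leLHS]mulr_natl.
  apply: ler_sum => i _; rewrite normcM !normcX.
  have -> : n.-1 = ((n - i.+1) + i)%N by rewrite -{1}(subnK (ltn_ord i)) addnS.
  rewrite exprD addnK.
  apply: ler_pM; rewrite ?exprn_ge0 ?normc_ge0 // lerXn2r ?nnegrE ?normc_ge0 //.
  by rewrite addrC.
apply: cvg_near_eq (tannery bc gl lb gb).
apply: filterS hr => h [zh h0].
have zh1 : normc (z + h) < 1 by apply: le_lt_trans zh _.
have s1 := summable_pser cK zh1; have s2 := summable_pser cK z1.
have := csum_linear (- h^-1) s2 (summableZ h^-1 s1).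
have -> : (fun n => - h^-1 * ((c n)%:C * z ^+ n) + h^-1 * ((c n)%:C * (z + h) ^+ n)) =
    g ^~ h.
  by apply/funext => n; rewrite /g mulrBr mulNr addrC.
by rewrite /pser => ->; rewrite csumZ // mulrBr mulNr addrC.
Qed.

Lemma pser_cvg (T : Type) (F : set_system T) {FF : Filter F} (c : nat -> R)
    (x : T -> C) (z : C) :
  cvgn (series (fun n => `|c n|)) -> normc z <= 1 ->
  (\forall t \near F, normc (x t) <= 1) -> x @ F --> z ->
  pser c (x t) @[t --> F] --> pser c z.
Proof.
move=> cc z1 x1 xz.
have pb (y : C) n : normc y <= 1 -> normc ((c n)%:C * y ^+ n) <= `|c n|.
  move=> y1; rewrite normcM normc_real normcX ler_piMr //.
  by rewrite exprn_ile1 // normc_ge0.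
apply: (tannery (g := fun n t => (c n)%:C * x t ^+ n) cc) => [n|n|].
- suff xn : x t ^+ n @[t --> F] --> z ^+ n by exact: (cvgM (cvg_cst ((c n)%:C : C)) xn).
  elim: n => [|n IHn]; first by under eq_fun do rewrite expr0; exact: cvg_cst.
  by rewrite exprS; under eq_fun do rewrite exprS; exact: (cvgM xz IHn).
- exact: pb.
- by apply: filterS x1 => t t1 n; exact: pb.
Qed.

Definition Lam w := pser (lcoef R w).

Lemma lcoef_norm_le1 w n : `|lcoef R w n| <= 1.
Proof. by rewrite ger0_norm ?lcoef_ge0 ?lcoef_le1. Qed.

Definition omega (a : letter) z : C := if a is xa then (1 - z)^-1 else z^-1.

Lemma normc_lt1_neq1 z : normc z < 1 -> 1 - z != 0.
Proof. by apply: contraTneq => /subr0_eq <-; rewrite normc1 ltxx. Qed.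

Lemma Lam_nil z : Lam [::] z = 1.
Proof.
apply: csumE; rewrite -(cvg_shiftS (series _)).
rewrite (_ : [sequence _]_n = cst 1); first exact: cvg_cst.
apply/funext => n; rewrite /series /= big_nat_recl // lcoef_nil /= expr0 mulr1.
by rewrite big1 ?addr0 // => i _; rewrite lcoef_nil mul0r.
Qed.

Lemma Lam0 w a : Lam (rcons w a) 0 = 0.
Proof.
apply: csumE; rewrite (_ : series _ = cst 0); first exact: cvg_cst.
apply/funext => n; rewrite /series /= big1 // => -[|i] _.
  by rewrite lcoef0 mul0r.
by rewrite expr0n mulr0.
Qed.

Lemma dpser_coef_b w z : normc z < 1 ->
  z * pser (dpser (lcoef R (rcons w xb))) z = Lam w z - (lcoef R w 0)%:C.
Proof.
move=> z1; have sw := summable_pser (lcoef_norm_le1 w) z1.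
have sb := summable_dpser (lcoef_norm_le1 (rcons w xb)) z1.
rewrite /Lam /pser -csumZ // (csum_shift sw) expr0 mulr1 addrC addKr.
congr csum; apply/funext => n.
by rewrite /dpser lcoef_b [n.+1%:R * _]mulrC divfK ?pnatr_eq0 // exprS mulrCA.
Qed.

Lemma dpser_coef_a w z : normc z < 1 ->
  (1 - z) * pser (dpser (lcoef R (rcons w xa))) z = Lam w z.
Proof.
move=> z1; have sw := summable_pser (lcoef_norm_le1 w) z1.
have sb := summable_dpser (lcoef_norm_le1 (rcons w xa)) z1.
rewrite mulrBl mul1r /Lam /pser [in X in X - _]csum_shift // -(csumZ z sb).
have := csum_linear (- 1) (summableZ z sb) (summable_shift sb).
rewrite mulN1r => E; rewrite -addrA [X in _ + X]addrC -E (csum_shift sw).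
have dE n : dpser (lcoef R (rcons w xa)) n = \sum_(m < n.+1) lcoef R w m.
  by rewrite /dpser lcoef_a [n.+1%:R * _]mulrC divfK // pnatr_eq0.
congr (_ + _).
  by rewrite dE big_ord_recr big_ord0 /= add0r.
congr csum; apply/funext => n; rewrite !dE [in X in _ + X]big_ord_recr /= rmorphD /=.
by rewrite mulN1r exprS mulrCA mulrDl addrA addNr add0r.
Qed.

Lemma is_derive_Lam w a z : normc z < 1 -> z != 0 -> Wp (rcons w a) ->
  is_derive z (1 : C) (Lam (rcons w a)) (omega a z * Lam w z).
Proof.
move=> z1 z0 wa; apply: (is_derive_eq (is_derive_pser (lcoef_norm_le1 _) z1)).
case: a wa => wa.
  by rewrite -(dpser_coef_a w z1) mulKf ?normc_lt1_neq1.
(* A word of Wp ending with b has a nonempty prefix w, so L_w has no constant term and L_w(z)/z is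
   regular at 0. *)
have c0 : lcoef R w 0 = 0.
  by case/lastP: w wa => // w c _; rewrite lcoef0.
by have := dpser_coef_b w z1; rewrite c0 subr0 => <-; rewrite mulKf.
Qed.

Lemma Lam_dcoef w z : normc z < 1 -> (1 - z) * Lam w z = pser (dcoef R w) z.
Proof.
move=> z1; have sw := summable_pser (lcoef_norm_le1 w) z1.
rewrite mulrBl mul1r /Lam /pser -(csumZ z sw).
have sd : summable (fun n => (dcoef R w n)%:C * z ^+ n).
  by apply: (@summable_pser_le1 (dcoef R w)); [exact: cvg_series_dcoef|exact: ltW].
rewrite (csum_shift sw) (csum_shift sd) /dcoef subr0 -addrA; congr (_ + _).
have := csum_linear (- 1) (summableZ z sw) (summable_shift sw).
rewrite mulN1r addrC => <-; congr csum; apply/funext => n.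
by rewrite mulN1r exprS mulrCA rmorphB mulrBl addrC.
Qed.

Lemma pser_dcoef1 w : pser (dcoef R w) 1 = 0.
Proof.
apply: csumE; rewrite -(cvg_shiftS (series _)).
have E n : series (fun n => (dcoef R w n)%:C * 1 ^+ n) n.+1 = (lcoef R w n)%:C :> C.
  rewrite -series_dcoef /series /= rmorph_sum /=; apply: eq_bigr => i _.
  by rewrite expr1n mulr1.
rewrite (_ : [sequence _]_n = (fun n => (lcoef R w n)%:C)); last by apply/funext.
apply: cvg_complex => /=; last exact: cvg_cst.
by change (lcoef R w n @[n --> \oo] --> (0 : R)); exact: cvg_coef.
Qed.

Lemma cvg_Lam (T : Type) (F : set_system T) {FF : Filter F} w (x : T -> C) (z : C) :
  normc z <= 1 -> z != 1 -> (\forall t \near F, normc (x t) < 1) -> x @ F --> z ->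
  Lam w (x t) @[t --> F] --> pser (dcoef R w) z / (1 - z).
Proof.
move=> z1 zn1 x1 xz; have z10 : 1 - z != 0 by rewrite subr_eq0 eq_sym.
have x1' : \forall t \near F, normc (x t) <= 1 by apply: filterS x1 => t /ltW.
have pc := pser_cvg (FF := FF) (@cvg_series_dcoef R w) z1 x1' xz.
refine (cvg_near_eq _ (cvgM pc (cvgV z10 (cvgB (cvg_cst (1 : C)) xz)))).
apply: filterS x1 => t t1 /=.
by rewrite -Lam_dcoef // mulrC mulKf ?normc_lt1_neq1.
Qed.

Lemma cvg_mul_Lam (T : Type) (F : set_system T) {FF : Filter F} w (x : T -> C) :
  (\forall t \near F, normc (x t) < 1) -> x @ F --> (1 : C) ->
  (1 - x t) * Lam w (x t) @[t --> F] --> (0 : C).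
Proof.
move=> x1 xz; rewrite -(pser_dcoef1 w).
have x1' : \forall t \near F, normc (x t) <= 1 by apply: filterS x1 => t /ltW.
have n1 : normc (1 : C) <= 1 by rewrite normc1.
apply: cvg_near_eq (pser_cvg (@cvg_series_dcoef R w) n1 x1' xz).
by apply: filterS x1 => t t1; rewrite Lam_dcoef.
Qed.

Lemma cvg_Lam_b (T : Type) (F : set_system T) {FF : Filter F} w (x : T -> C) :
  (\forall t \near F, normc (x t) < 1) -> x @ F --> (1 : C) ->
  Lam (rcons w xb) (x t) @[t --> F] --> Lam (rcons w xb) 1.
Proof.
move=> x1 xz; have ac : (fun n => `|lcoef R (rcons w xb) n|) = lcoef R (rcons w xb).
  by apply/funext => n; rewrite ger0_norm ?lcoef_ge0.
apply: pser_cvg => //; last by apply: filterS x1 => t /ltW.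
  by rewrite ac; exact: cvg_series_coef_b.
by rewrite normc1.
Qed.

End PowerSeries.

(** * Functions with zero derivative along a segment *)

Section SegmentConstant.
Variable R : realType.
Notation C := (R[i])^o.
Implicit Types (z w : C) (f g : C -> C).

Lemma is_deriveMc f g z (a b : C) :
  is_derive z (1 : C) f a -> is_derive z (1 : C) g b ->
  is_derive z (1 : C) (fun y => f y * g y) (a * g z + f z * b).
Proof.
move=> df dg; apply: (is_derive_eq (is_deriveM df dg)).
by rewrite -[_ *: b]/(_ * b) -[_ *: a]/(_ * a) addrC (mulrC a).
Qed.

Lemma is_deriveZc f z (k a : C) :
  is_derive z (1 : C) f a -> is_derive z (1 : C) (fun y => k * f y) (k * a).
Proof. by move=> df; exact: (is_deriveZ k df). Qed.

Lemma is_derive_bigsum (I : eqType) (s : seq I) (f : I -> C -> C) (d : I -> C) z :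
  (forall i, i \in s -> is_derive z (1 : C) (f i) (d i)) ->
  is_derive z (1 : C) (fun y => \sum_(i <- s) f i y) (\sum_(i <- s) d i).
Proof.
elim: s => [|i s IHs] ds.
  rewrite big_nil; rewrite (_ : (fun _ => _) = cst 0); first exact: is_derive_cst.
  by apply/funext => y; rewrite big_nil.
rewrite big_cons; rewrite (_ : (fun _ => _) = f i \+ (fun y => \sum_(i <- s) f i y)).
  apply: is_deriveD; first by apply: ds; rewrite inE eqxx.
  by apply: IHs => j js; apply: ds; rewrite inE js orbT.
by apply/funext => y; rewrite big_cons.
Qed.

Lemma is_derive_continuous f z (a : C) :
  is_derive z (1 : C) f a -> f y @[y --> z] --> f z.
Proof. by move=> [/derivable1_diffP/differentiable_continuous]. Qed.

Lemma is_derive_compc f g z (a b : C) :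
  is_derive z (1 : C) f a -> is_derive (f z) (1 : C) g b ->
  is_derive z (1 : C) (g \o f) (a * b).
Proof.
move=> [df1 <-] [dg1 <-]; apply: DeriveDef.
  apply/derivable1_diffP; exact: (differentiable_comp
    (proj1 (derivable1_diffP _ _) df1) (proj1 (derivable1_diffP _ _) dg1)).
move/derivable1_diffP in df1; move/derivable1_diffP in dg1.
have dgf := differentiable_comp df1 dg1.
rewrite -!derive1E (derive1E' dgf) (diff_comp df1 dg1) (derive1E' df1) (derive1E' dg1) /=.
rewrite -[X in 'd g (f z) X = _]mulr1.
by rewrite [LHS]linearZ.
Qed.

Lemma is_derive_line f z w (t : R) (k l : C) :
  is_derive (z + t%:C * w) (1 : C) f l ->
  is_derive t (1 : R) (fun s => complex.Re (k * f (z + s%:C * w))) (complex.Re (k * (w * l))).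
Proof.
move=> /is_deriveP df.
pose q (s : R) : C := (s%:C)^-1 * (f (z + (t + s)%:C * w) - f (z + t%:C * w)).
suff ql : q s @[s --> (0 : R)^'] --> (w * l : C).
  have E : (fun h : R => h^-1 *: (((fun s => complex.Re (k * f (z + s%:C * w))) \o shift t) (h *: (1 : R)) -
      complex.Re (k * f (z + t%:C * w)))) = (fun s => complex.Re (k * q s)).
    apply/funext => h /=; rewrite -[h *: 1]/(h * 1) mulr1 (addrC h) /q.
    rewrite -ReB -mulrBr mulrCA -[_^-1]/(h^-1 : R) -fmorphV /=.
    by case: (k * _) => x y /=; rewrite mul0r subr0.
  have kq : complex.Re (k * q s) @[s --> (0 : R)^'] --> complex.Re (k * (w * l)).
    exact: (cvg_Re (cvgM (cvg_cst k) ql)).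
  apply: DeriveDef; first by rewrite /derivable E; apply/cvg_ex; eexists; exact: kq.
  by rewrite /derive E; apply/cvg_lim.
have [w0|w0] := eqVneq w 0.
  rewrite w0 mul0r (_ : q = cst 0); first exact: cvg_cst.
  by apply/funext => s; rewrite /q w0 !mulr0 subrr mulr0.
have sw : (fun s : R => s%:C * w : C) @ (0 : R)^' --> (0 : C)^'.
  move=> A [e /= e0 eA].
  have er : e = (complex.Re e)%:C by apply/esym/RRe_real/gtr0_real.
  have wp : 0 < normc w.
    rewrite lt_neqAle normc_ge0 andbT eq_sym.
    by apply: contra w0 => /eqP/eq0_normc ->.
  have e0' : 0 < complex.Re e by move: e0; rewrite er -[0]/(0%:C) ltcR.
  exists (complex.Re e / normc w); first by rewrite /= divr_gt0.
  move=> s /=; rewrite sub0r normrN ltr_pdivlMr // => se s0; apply: eA.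
    by rewrite /ball_ /= sub0r normrN normC_normc normcM normc_real er ltcR.
  rewrite mulf_neq0 //; apply: contra s0; rewrite eq_complex /= eqxx andbT.
  by move=> /eqP ->.
refine (cvg_near_eq _ (cvgM (cvg_cst w) (cvg_comp _ _ sw df))).
exists 1 => //= s _ s0; rewrite /q rmorphD mulrDl addrA /= invfM.
by rewrite mulrA (mulrCA w) mulfV // mulr1.
Qed.

(** The real mean value theorem applied to the real part of [k * f] along the segment; [k = 1] and
    [k = -i] recover the two parts of f. Differentiability is asked only in the open segment, so an
    endpoint may be singular for the derivative formula. *)
Lemma segment_const f z w :
  (forall t : R, 0 < t < 1 -> is_derive (z + t%:C * w) (1 : C) f 0) ->
  (forall t : R, 0 <= t <= 1 -> f y @[y --> (z + t%:C * w : C)] --> f (z + t%:C * w)) ->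
  f (z + w) = f z.
Proof.
move=> df fc; suff E k : complex.Re (k * (f (z + w) - f z)) = 0.
  apply/eqP; rewrite -subr_eq0; have := E (Complex 0 (-1)); have := E 1; move: (f _ - f _) => [x y].
  rewrite mul1r /= mul0r sub0r mulN1r opprK => -> ->.
  by [].
pose g s := complex.Re (k * f (z + s%:C * w)).
have dg (t : R) : t \in `]0, 1[%R -> is_derive t (1 : R) g 0.
  rewrite in_itv /= => /df /(is_derive_line k) dt; apply: (is_derive_eq dt).
  by rewrite !mulr0.
have lc (t : R) : (fun s : R => z + s%:C * w : C) @ t --> (z + t%:C * w : C).
  apply: (cvgD (cvg_cst z)); apply: cvgM; last exact: cvg_cst.
  by apply: cvg_complex; [exact: cvg_id|exact: cvg_cst].
have gc : {within `[0, 1], continuous g}.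
  apply: continuous_in_subspaceT => t; rewrite inE /= in_itv /= => t01.
  exact: (cvg_Re (cvgM (cvg_cst k) (cvg_comp _ _ (lc t) (fc t t01)))).
have [c _] := MVT_segment (@ler01 R) dg gc.
rewrite mul0r /g mul0r addr0 mul1r => /eqP; rewrite -ReB -mulrBr => /eqP.
exact.
Qed.

End SegmentConstant.

(** * Shuffle relations between the power series, and their agreement with [Li] *)

Lemma Wp_belast w c : Wp (rcons w c) -> Wp w.
Proof. by case: w. Qed.

Lemma Wp_rcons w c : Wp w -> w != [::] -> Wp (rcons w c).
Proof. by case: w. Qed.

Lemma interleavings_neq0 u v w :
  w \in interleavings u v -> (u != [::]) || (v != [::]) -> w != [::].
Proof.
case: u v => [|c u] [|d v] //=; rewrite ?inE; try by move=> /eqP ->.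
by rewrite mem_cat => /orP[] /mapP[x _ ->].
Qed.

Section LamMorphism.
Variable R : realType.
Notation C := (R[i])^o.
Implicit Types (z : C).

Let dLam w z : C := pser (dpser (lcoef R w)) z.

Lemma Lam_derivable w z : normc z < 1 -> is_derive z (1 : C) (@Lam R w) (dLam w z).
Proof. by move=> z1; exact: (is_derive_pser (lcoef_norm_le1 R w) z1). Qed.

(* Both sides vanish at 0 and, by induction, have the same derivative. *)
Lemma Lam_mul u v z : Wp u -> Wp v -> normc z < 1 ->
  shsum u v (fun w => Lam w z) = Lam u z * Lam v z.
Proof.
have [n] := ubnP (size u + size v); elim: n u v z => // n IHn.
case/lastP => [|u c] v z; first by rewrite shsum0s Lam_nil mul1r.
case/lastP: v => [|v d]; first by rewrite shsums0 Lam_nil mulr1.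
rewrite ltnS !size_rcons => sz uc vd z1.
pose s1 := interleavings u (rcons v d); pose s2 := interleavings (rcons u c) v.
pose g y : C := Lam (rcons u c) y * Lam (rcons v d) y -
  (\sum_(w <- s1) Lam (rcons w c) y + \sum_(w <- s2) Lam (rcons w d) y).
suff : g z = 0.
  by rewrite /g => /subr0_eq ->; rewrite shsum_rcons.
have rn0 (w : word) e : rcons w e != [::] by case: (w).
have s1p w : w \in s1 -> Wp (rcons w c).
  move=> ws; apply: Wp_rcons; first exact: interleavings_Wp (Wp_belast uc) vd ws.
  by apply: interleavings_neq0 ws _; rewrite rn0 orbT.
have s2p w : w \in s2 -> Wp (rcons w d).
  move=> ws; apply: Wp_rcons; first exact: interleavings_Wp uc (Wp_belast vd) ws.
  by apply: interleavings_neq0 ws _; rewrite rn0.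
have g0 : g 0 = 0.
  rewrite /g !Lam0 mul0r !big1 ?addr0 ?subr0 // => w _; exact: Lam0.
have [->//|z0] := eqVneq z 0.
have tz (t : R) : 0 <= t <= 1 -> normc (0 + t%:C * z) < 1.
  move=> /andP[t0 t1]; rewrite add0r normcM normc_real ger0_norm //.
  by apply: le_lt_trans z1; rewrite ler_piMl ?normc_ge0.
have dg (y : C) a1 a2 (b1 b2 : word -> C) :
    is_derive y (1 : C) (@Lam R (rcons u c)) a1 ->
    is_derive y (1 : C) (@Lam R (rcons v d)) a2 ->
    (forall w, w \in s1 -> is_derive y (1 : C) (@Lam R (rcons w c)) (b1 w)) ->
    (forall w, w \in s2 -> is_derive y (1 : C) (@Lam R (rcons w d)) (b2 w)) ->
    is_derive y (1 : C) g (a1 * Lam (rcons v d) y + Lam (rcons u c) y * a2 -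
      (\sum_(w <- s1) b1 w + \sum_(w <- s2) b2 w)).
  move=> d1 d2 d3 d4; apply: is_deriveB; first exact: is_deriveMc.
  by apply: is_deriveD; apply: is_derive_bigsum.
have gc (y : C) : normc y < 1 -> g x @[x --> y] --> g y.
  move=> y1; have dy w := Lam_derivable w y1.
  apply: is_derive_continuous; apply: (dg y (dLam (rcons u c) y) (dLam (rcons v d) y)
    (fun w => dLam (rcons w c) y) (fun w => dLam (rcons w d) y)).
suff : g (0 + z) = g 0 by rewrite add0r g0.
apply: segment_const => t t01; last exact/gc/tz.
have {}tz : normc (0 + t%:C * z) < 1.
  by apply: tz; case/andP: t01 => /ltW -> /ltW ->.
have tz0 : 0 + t%:C * z != 0.
  rewrite add0r mulf_neq0 //; case/andP: t01 => t0 _.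
  by rewrite eq_complex /= eqxx andbT gt_eqF.
move: (0 + _) tz tz0 => y y1 y0.
have dL w e : Wp (rcons w e) -> _ := @is_derive_Lam R w e y y1 y0.
apply: (is_derive_eq (dg y _ _ (fun w => omega c y * Lam w y) (fun w => omega d y * Lam w y)
  (dL _ _ uc) (dL _ _ vd)
  (fun w ws => dL _ _ (s1p w ws)) (fun w ws => dL _ _ (s2p w ws)))).
rewrite -!mulr_sumr.
have := IHn u (rcons v d) y; rewrite /shsum size_rcons -/s1 => -> //; last first.
  exact: Wp_belast uc.
have := IHn (rcons u c) v y; rewrite /shsum size_rcons -/s2 => -> //; last first.
- exact: Wp_belast vd.
- by rewrite addSn -addnS.
by rewrite -mulrA (mulrCA (Lam (rcons u c) y)) subrr.
Qed.

Lemma lcoef_nseq_b w m n : lcoef R (w ++ nseq m xb) n = lcoef R w n / n%:R ^+ m.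
Proof.
elim: m n => [|m IHm] n; first by rewrite cats0 expr0 divr1.
have -> : nseq m.+1 xb = rcons (nseq m xb) xb by elim: (m) => //= k ->.
by rewrite -rcons_cat lcoef_b IHm exprSr invfM mulrA.
Qed.

Lemma of_exponents_rcons r x :
  of_exponents (rcons r x) = rcons (of_exponents r) xa ++ nseq x.-1 xb.
Proof. by rewrite /of_exponents map_rcons flatten_rcons cat_rcons. Qed.

Lemma lcoef_of_exponents r x n : (0 < x)%N ->
  lcoef R (of_exponents (rcons r x)) n =
  (\sum_(m < n) lcoef R (of_exponents r) m) / n%:R ^+ x.
Proof.
case: x => // x _; rewrite of_exponents_rcons lcoef_nseq_b lcoef_a /=.
by rewrite exprS invfM mulrA.
Qed.

(** The weight [g] is arbitrary because summing over the largest index n_k leaves, for the shorter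
    tuple, the new weight [G] in n_(k-1). With [0 < N] the index n = 0, which carries the empty
    tuple, is in range. *)
Lemma sum_tuple_Li (N k : nat) (r : seq nat) (g : nat -> C) :
  (0 < N)%N -> size r = k -> all (ltn 0) r ->
  \sum_(t : k.-tuple 'I_N | path ltn 0%N (map val t))
    (\prod_(i < k) (tnth t i)%:R ^- (nth 0%N r i)) * g (last 0%N (map val t)) =
  \sum_(n < N) (lcoef R (of_exponents r) n)%:C * g n.
Proof.
move=> N0.
have tE (j : nat) (t : j.-tuple 'I_N) (i : 'I_j) :
    (tnth t i)%:R = (nth 0%N (map val t) i)%:R :> C.
  by rewrite -(tnth_nth 0%N (map_tuple val t)) tnth_map.
elim: k r g => [|k IHk] r g.
  move=> /size0nil -> _; rewrite (big_pred1 [tuple]) => [|t]; last first.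
    by rewrite (tuple0 t) /=; apply/esym/eqP.
  rewrite big_ord0 mul1r /=; case: N N0 {tE} => // N _.
  rewrite big_ord_recl lcoef_nil /= mul1r big1 ?addr0 // => i _.
  by rewrite lcoef_nil /= mul0r.
case/lastP: r => [//|r x]; rewrite size_rcons all_rcons => -[rk] /andP[x0 rp].
pose h (p : k.-tuple 'I_N * 'I_N) : k.+1.-tuple 'I_N := [tuple of rcons p.1 p.2].
have hb : bijective h.
  apply: inj_card_bij; last by rewrite card_prod !card_tuple card_ord expnSr.
  move=> [t i] [u j] /(congr1 val) /= /eqP; rewrite eqseq_rcons => /andP[/eqP tu /eqP ->].
  by congr pair; apply/val_inj.
rewrite (reindex h) /=; last exact: onW_bij.
have hE (t : k.-tuple 'I_N) (i : 'I_N) : map val (h (t, i)) = rcons (map val t) (val i).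
  by rewrite /= map_rcons.
have PE (t : k.-tuple 'I_N) (i : 'I_N) :
    \prod_(j < k.+1) (tnth (h (t, i)) j)%:R ^- (nth 0%N (rcons r x) j) =
    (\prod_(j < k) (tnth t j)%:R ^- (nth 0%N r j)) * (val i)%:R ^- x :> C.
  have P1 (j : 'I_k) : (tnth (h (t, i)) (widen_ord (leqnSn k) j))%:R ^-
      nth 0%N (rcons r x) j = (tnth t j)%:R ^- nth 0%N r j :> C.
    by rewrite !tE hE !nth_rcons size_map size_tuple rk /= ltn_ord.
  have P2 : (tnth (h (t, i)) ord_max)%:R ^- nth 0%N (rcons r x) k = (val i)%:R ^- x :> C.
    by rewrite tE hE !nth_rcons size_map size_tuple rk ltnn eqxx.
  rewrite big_ord_recr; apply: (f_equal2 *%R); last exact: P2.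
  by apply: eq_bigr => j _; exact: P1.
have E (p : k.-tuple 'I_N * 'I_N) : path ltn 0%N (map val (h p)) =
    path ltn 0%N (map val p.1) && (last 0%N (map val p.1) < p.2)%N.
  by rewrite /= map_rcons rcons_path.
under eq_bigl do rewrite E.
rewrite -(pair_big_dep (fun t : k.-tuple 'I_N => path ltn 0%N (map val t))
  (fun (t : k.-tuple 'I_N) (i : 'I_N) => (last 0%N (map val t) < i)%N)
  (fun t i => (\prod_(j < k.+1) (tnth (h (t, i)) j)%:R ^- (nth 0%N (rcons r x) j)) *
     g (last 0%N (map val (h (t, i)))))) /=.
pose G (m : nat) : C := \sum_(i < N | (m < i)%N) i%:R ^- x * g i.
transitivity (\sum_(t : k.-tuple 'I_N | path ltn 0%N (map val t))
    (\prod_(i < k) (tnth t i)%:R ^- (nth 0%N r i)) * G (last 0%N (map val t))).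
  apply: eq_bigr => t _; rewrite /G mulr_sumr; apply: eq_bigr => i _.
  by rewrite PE hE last_rcons mulrA.
rewrite IHk //.
transitivity (\sum_(n < N) \sum_(i < N | (n < i)%N)
    (lcoef R (of_exponents r) n)%:C * (i%:R ^- x * g i)).
  by apply: eq_bigr => n _; rewrite /G mulr_sumr.
rewrite (exchange_big_dep predT) //=; apply: eq_bigr => i _.
rewrite lcoef_of_exponents // rmorphM /= fmorphV rmorphXn /= rmorph_nat.
rewrite rmorph_sum /= -mulrA mulr_suml.
rewrite (big_ord_widen N (fun m => (lcoef R (of_exponents r) m)%:C * (i%:R ^- x * g i))) //.
exact: ltnW.
Qed.

Lemma exponents_gt0 w : all (ltn 0) (exponents w).
Proof. by rewrite /exponents; elim: w => [|[] w IHw] //=. Qed.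

Lemma Li_truncE w z N : Wp w -> (0 < N)%N ->
  Li_trunc (exponents w) z N = series (fun n => (lcoef R w n)%:C * z ^+ n) N.
Proof.
move=> wp N0; rewrite /Li_trunc (sum_tuple_Li (fun n => z ^+ n) N0 erefl (exponents_gt0 w)).
by rewrite exponentsK // /series /= big_mkord.
Qed.

Lemma Li_Lam w z : Wp w -> Li (exponents w) z = Lam w z.
Proof.
move=> wp; rewrite /Li /Lam /pser /csum; congr (lim _).
have E : \forall N \near \oo, Li_trunc (exponents w) z N =
    series (fun n => (lcoef R w n)%:C * z ^+ n) N.
  by exists 1%N => // N /= N1; apply: Li_truncE.
rewrite eqEsubset; split; apply: near_eq_cvg => //.
by apply: filterS E => N ->.
Qed.

End LamMorphism.

(** * The complex logarithm *)

Section Logarithm.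
Variable R : realType.
Notation C := (R[i])^o.
Implicit Types (z w : C).

Lemma ReM z1 z2 : complex.Re (z1 * z2) =
  complex.Re z1 * complex.Re z2 - complex.Im z1 * complex.Im z2.
Proof. by case: z1 z2 => ? ? []. Qed.

Lemma ImM z1 z2 : complex.Im (z1 * z2) =
  complex.Re z1 * complex.Im z2 + complex.Im z1 * complex.Re z2.
Proof. by case: z1 z2 => ? ? []. Qed.

Lemma ReD z1 z2 : complex.Re (z1 + z2) = complex.Re z1 + complex.Re z2.
Proof. by case: z1 z2 => ? ? []. Qed.

Lemma ImD z1 z2 : complex.Im (z1 + z2) = complex.Im z1 + complex.Im z2.
Proof. by case: z1 z2 => ? ? []. Qed.

Lemma complexP z1 z2 : complex.Re z1 = complex.Re z2 ->
  complex.Im z1 = complex.Im z2 -> z1 = z2.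
Proof. by case: z1 z2 => ? ? [? ?] /= -> ->. Qed.

Lemma normc_gt0 z : (0 < normc z) = (z != 0).
Proof.
rewrite lt_neqAle normc_ge0 andbT eq_sym; congr (~~ _).
by apply/eqP/eqP => [/eq0_normc|->] //; rewrite normc0.
Qed.

Lemma Re_cexp z : complex.Re (cexp z) = expR (complex.Re z) * cos (complex.Im z).
Proof. by rewrite /cexp ReM /= mul0r subr0. Qed.

Lemma Im_cexp z : complex.Im (cexp z) = expR (complex.Re z) * sin (complex.Im z).
Proof. by rewrite /cexp ImM /= mul0r addr0. Qed.

Lemma cexpD z1 z2 : cexp (z1 + z2) = cexp z1 * cexp z2.
Proof.
apply: complexP.
  by rewrite [RHS]ReM !Re_cexp !Im_cexp ReD ImD expRD cosD; ring.
by rewrite [RHS]ImM !Re_cexp !Im_cexp ReD ImD expRD sinD; ring.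
Qed.

Lemma cexp0 : cexp (0 : C) = 1.
Proof. by apply: complexP; rewrite ?Re_cexp ?Im_cexp /= expR0 ?cos0 ?sin0 mul1r. Qed.

Lemma cexpN z : cexp z * cexp (- z) = 1.
Proof. by rewrite -cexpD subrr cexp0. Qed.

Lemma cexp_neq0 z : cexp z != 0.
Proof. by apply/eqP => z0; have := cexpN z; rewrite z0 mul0r => /esym/eqP; rewrite oner_eq0. Qed.

Lemma normc_cexp z : normc (cexp z) = expR (complex.Re z).
Proof.
rewrite /cexp normcM normc_real ger0_norm ?expR_ge0 //= cos2Dsin2 sqrtr1 mulr1 //.
Qed.

Lemma real_diff0 (f : R -> R) (l : R) (e : R) : is_derive (0 : R) (1 : R) f l -> 0 < e ->
  \forall h \near (0 : R), `|f h - f 0 - h * l| <= e * `|h|.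
Proof.
move=> [df <-] e0; have : h^-1 *: ((f \o shift 0) (h *: (1 : R)) - f 0)
    @[h --> (0 : R)^'] --> 'D_1 f (0 : R) by exact: df.
move=> /cvgrPdist_lt/(_ e e0) [d /= d0 hd].
exists d => //= h hh; have [->|h0] := eqVneq h 0.
  by rewrite subrr mul0r subr0 !normr0 mulr0.
have := hd h hh h0; rewrite -[h *: 1]/(h * 1) mulr1 addr0 -[_ *: _]/(_ * _) => le.
have -> : f h - f 0 - h * 'D_1 f (0 : R) = h * - ('D_1 f (0 : R) - h^-1 * (f h - f 0)).
  by rewrite opprB mulrBr mulVKf.
by rewrite normrM normrN mulrC ler_wpM2r // ltW.
Qed.

Lemma normc_le_ReIm z (b : R) : `|complex.Re z| <= b -> `|complex.Im z| <= b ->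
  normc z <= 2 * b.
Proof. by move=> rb ib; apply: le_trans (normc_le z) _; lra. Qed.

Lemma is_derive_cexp0 : is_derive (0 : C) (1 : C) (@cexp R) 1.
Proof.
apply/is_deriveP/ccvgP => Re0 Re0p.
(* With n = |h| < e, the first-order expansions of exp, cos and sin leave an error of at most 2 (4 e
   n + 2 n^2) <= 12 e n; the factor 20 leaves room. *)
have [e [e0 e1 e2]] : exists e : R, [/\ 0 < e, e <= 1 & e * 20 <= Re0].
  exists (Num.min 1 (Re0 / 20)); split.
  - by rewrite lt_min ltr01 divr_gt0.
  - by rewrite ge_min lexx.
  - by rewrite -ler_pdivlMr // ge_min lexx orbT.
have [d1 /= d10 Hd1] := real_diff0 (is_derive_expR (0 : R)) e0.
have [d2 /= d20 Hd2] := real_diff0 (is_derive_sin (0 : R)) e0.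
have [d3 /= d30 Hd3] := real_diff0 (is_derive_cos (0 : R)) e0.
pose d := Num.min (Num.min d1 d2) (Num.min d3 e).
have d0 : 0 < d by rewrite !lt_min d10 d20 d30 e0.
have dC : (0 : R[i]) < d%:C by rewrite -[0]/(0%:C) ltcR.
exists d%:C; first exact: dC.
move=> h /=; rewrite sub0r normrN normC_normc ltcR => hd h0.
have hp : 0 < normc h by rewrite normc_gt0.
have -> : 1 - h^-1 * (cexp (0 + h) - cexp (0 : C)) = - (h^-1 * (cexp h - 1 - h)).
  by rewrite add0r cexp0 !mulrBr mulVf // [RHS]opprB.
rewrite normcN normcM normcV mulrC ltr_pdivrMr //.
move: hd; rewrite !lt_min => /andP[/andP[hd1 hd2] /andP[hd3 hde]].
have xn := normc_Re h; have yn := normc_Im h.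
pose D := cexp h - 1 - h; rewrite -/D.
have DRe : complex.Re D = expR (complex.Re h) * cos (complex.Im h) - 1 - complex.Re h.
  by rewrite /D !ReB Re_cexp.
have DIm : complex.Im D = expR (complex.Re h) * sin (complex.Im h) - complex.Im h.
  by rewrite /D !ImB Im_cexp /= subr0.
move: (D) DRe DIm => {}D; move: (normc h) (complex.Re h) (complex.Im h) xn yn hp hd1 hd2 hd3 hde.
move=> n x y xn yn hp hd1 hd2 hd3 hde DRe DIm.
have := Hd1 x; rewrite /ball_ /= sub0r normrN expR0 mulr1 => /(_ (le_lt_trans xn hd1)) Ex.
have := Hd2 y; rewrite /ball_ /= sub0r normrN sin0 cos0 mulr1 subr0.
move=> /(_ (le_lt_trans yn hd2)) Sy.
have := Hd3 y; rewrite /ball_ /= sub0r normrN cos0 sin0 oppr0 mulr0 subr0.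
move=> /(_ (le_lt_trans yn hd3)) Cy.
have en : e * `|x| <= e * n by rewrite ler_wpM2l // ltW.
have em : e * `|y| <= e * n by rewrite ler_wpM2l // ltW.
have x1 : `|expR x - 1| <= 2 * n.
  rewrite (_ : expR x - 1 = (expR x - 1 - x) + x); last by rewrite subrK.
  apply: le_trans (ler_normD _ _) _.
  have : e * n <= n by rewrite ler_piMl // ltW.
  lra.
have n1 : n <= 1 by apply: ltW; apply: lt_le_trans hde _.
have ex3 : expR x <= 3 by move: x1; rewrite ler_norml; lra.
have ex0 := expR_ge0 x.
apply: (@le_lt_trans _ _ (2 * (4 * (e * n) + 2 * n * n))); last first.
  have nn : n * n <= e * n by rewrite ler_wpM2r // ltW.
  have : e * 20 * n <= Re0 * n by rewrite ler_wpM2r // ltW.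
  have en0 : 0 < e * n by rewrite mulr_gt0.
  lra.
apply: normc_le_ReIm.
  rewrite DRe (_ : _ - _ = (expR x - 1 - x) + expR x * (cos y - 1)); last by ring.
  apply: le_trans (ler_normD _ _) _; rewrite normrM (ger0_norm ex0).
  have : expR x * `|cos y - 1| <= 3 * (e * `|y|) by rewrite ler_pM.
  have : 0 <= n * n by rewrite mulr_ge0 // ltW.
  lra.
rewrite DIm (_ : _ - _ = expR x * (sin y - y) + (expR x - 1) * y); last by ring.
apply: le_trans (ler_normD _ _) _; rewrite !normrM (ger0_norm ex0).
have : expR x * `|sin y - y| <= 3 * (e * `|y|) by rewrite ler_pM.
have : `|expR x - 1| * `|y| <= 2 * n * n by rewrite ler_pM.
have : 0 <= e * n by rewrite mulr_ge0 // ltW.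
lra.
Qed.

Lemma is_derive_cexp z : is_derive z (1 : C) (@cexp R) (cexp z).
Proof.
apply/is_deriveP; have /is_deriveP d0 := is_derive_cexp0.
have -> : (fun h : C => h^-1 * (cexp (z + h) - cexp z)) =
    cst (cexp z) \* (fun h => h^-1 * (cexp (0 + h) - cexp 0)).
  by apply/funext => h /=; rewrite add0r cexpD cexp0 [RHS]mulrCA [X in _ = _ * X]mulrBr mulr1.
rewrite -[X in _ --> X]mulr1; exact: (cvgM (cvg_cst (cexp z)) d0).
Qed.

Lemma clog_cexp z : - pi < complex.Im z <= pi -> clog (cexp z) = z.
Proof.
move=> /andP[Npi lepi]; have e0 := expR_gt0 (complex.Re z).
apply: complexP; rewrite /clog -/(normc _) normc_cexp /=; first exact: expRK.
rewrite /arg normc_cexp Re_cexp Im_cexp pmulr_rge0 //.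
have -> : expR (complex.Re z) * cos (complex.Im z) / expR (complex.Re z) = cos (complex.Im z).
  by rewrite mulrAC divff ?mul1r // gt_eqF.
case: (lerP 0 (complex.Im z)) => y0.
  by rewrite sin_ge0_pi ?y0 ?lepi // cosK // in_itv /= y0.
have s0 : sin (complex.Im z) < 0.
  by rewrite -oppr_gt0 -sinN sin_gt0_pi // oppr_gt0 y0 /= ltrNl.
by rewrite leNgt s0 /= -cosN cosK ?opprK // in_itv /= oppr_ge0 !ltW //= ltrNl.
Qed.

Lemma Re_polar z : z != 0 -> complex.Re z = normc z * cos (arg z).
Proof.
move=> z0; rewrite -{1}(cexp_clog z0) Re_cexp /= lnK //.
by rewrite posrE -/(normc _) normc_gt0.
Qed.

Lemma Im_polar z : z != 0 -> complex.Im z = normc z * sin (arg z).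
Proof.
move=> z0; rewrite -{1}(cexp_clog z0) Im_cexp /= lnK //.
by rewrite posrE -/(normc _) normc_gt0.
Qed.

Lemma arg_bounds z : z != 0 -> - pi < arg z <= pi.
Proof.
move=> z0; have n0 : 0 < normc z by rewrite normc_gt0.
have := Im_polar z0; rewrite /arg; set t := acos _.
have /andP[t0 tpi] : 0 <= t <= pi.
  have h : -1 <= complex.Re z / normc z <= 1.
    by rewrite -ler_norml normrM normfV (gtr0_norm n0) ler_pdivrMr // mul1r normc_Re.
  by rewrite acos_ge0 ?acos_lepi.
have pi0 := pi_gt0 R; case: (lerP 0 (complex.Im z)) => y0 E; first by rewrite tpi andbT; lra.
rewrite lterN2; apply/andP; split; last by lra.
rewrite lt_neqAle tpi andbT; apply/eqP => tE; move: y0.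
by rewrite E tE sinN sinpi oppr0 mulr0 ltxx.
Qed.

(** The plane cut along ]-oo, 0], on which [clog] is holomorphic. *)
Definition slit z := (0 < complex.Re z) || (complex.Im z != 0).

Lemma slit_neq0 z : slit z -> z != 0.
Proof. by apply: contraTneq => ->; rewrite /slit /= ltxx eqxx. Qed.

Lemma slit_arg z : slit z -> - pi < arg z < pi.
Proof.
move=> sz; have z0 := slit_neq0 sz.
have /andP[-> le] := arg_bounds z0; rewrite lt_neqAle le andbT /=; apply/eqP => E.
have n0 : 0 < normc z by rewrite normc_gt0.
move: sz; rewrite /slit (Im_polar z0) (Re_polar z0) E sinpi cospi mulr0 eqxx orbF.
by rewrite mulrN1 oppr_gt0; case: ltgtP n0.
Qed.

Lemma Lam_a_derive0 : is_derive (0 : C) (1 : C) (@Lam R [:: xa]) 1.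
Proof.
have n0 : normc (0 : C) < 1 by rewrite normc0.
apply: (is_derive_eq (is_derive_pser (lcoef_norm_le1 R [:: xa]) n0)).
have := dpser_coef_a [::] n0; rewrite subr0 mul1r => ->; exact: Lam_nil.
Qed.

Lemma is_derive_1B z : is_derive z (1 : C) (fun z => 1 - z) (-1).
Proof.
have := is_deriveB (is_derive_cst (1 : C) z (1 : C)) (is_derive_id z (1 : C)).
by rewrite sub0r.
Qed.

Lemma disc_const (g : C -> C) w : (forall z, normc z < 1 -> is_derive z (1 : C) g 0) ->
  normc w < 1 -> g w = g 0.
Proof.
move=> dg w1.
have tw (t : R) : 0 <= t <= 1 -> normc (0 + t%:C * w) < 1.
  move=> /andP[t0 t1]; rewrite add0r normcM normc_real ger0_norm //.
  by apply: le_lt_trans w1; rewrite ler_piMl ?normc_ge0.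
suff : g (0 + w) = g 0 by rewrite add0r.
apply: segment_const => t t01.
  by apply/dg/tw; case/andP: t01 => /ltW -> /ltW ->.
exact: is_derive_continuous (dg _ (tw t t01)).
Qed.

Lemma is_derive_Lam_a z : normc z < 1 ->
  is_derive z (1 : C) (@Lam R [:: xa]) (1 - z)^-1.
Proof.
move=> z1; have [->|z0] := eqVneq z 0; first by rewrite subr0 invr1; exact: Lam_a_derive0.
by have := is_derive_Lam (a := xa) (w := [::]) z1 z0 isT; rewrite /omega Lam_nil mulr1.
Qed.

(** Stated through [cexp] because the derivative of [clog] is deduced from it: L_a provides a
    holomorphic local inverse of [cexp] near 1. *)
Lemma cexp_Lam_a w : normc w < 1 -> cexp (- Lam [:: xa] w) = 1 - w.
Proof.
move=> w1; pose g z := cexp (Lam [:: xa] z) * (1 - z).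
suff E : g w = 1.
  by apply: (mulfI (cexp_neq0 (Lam [:: xa] w))); rewrite cexpN.
rewrite (_ : 1 = g 0); last by rewrite /g (Lam0 R [::] xa) cexp0 subr0 mul1r.
apply: disc_const w1 => z z1.
have d := is_derive_compc (is_derive_Lam_a z1) (is_derive_cexp (Lam [:: xa] z)).
apply: (is_derive_eq (is_deriveMc d (is_derive_1B z))) => /=.
by rewrite mulrAC mulVf ?normc_lt1_neq1 // mul1r mulrN1 subrr.
Qed.

Lemma slit_near z : slit z -> \forall y \near (z : C), slit y.
Proof.
move=> /orP[x0|y0].
  have dC : (0 : R[i]) < (complex.Re z)%:C by rewrite -[0]/(0%:C) ltcR.
  exists (complex.Re z)%:C; first exact: dC.
  move=> y; rewrite /ball_ /= normC_normc ltcR => zy; apply/orP; left.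
  have := le_lt_trans (normc_Re (z - y)) zy; rewrite ReB ltr_norml; lra.
have y0' : 0 < `|complex.Im z| by rewrite normr_gt0.
have dC : (0 : R[i]) < (`|complex.Im z|)%:C by rewrite -[0]/(0%:C) ltcR.
exists (`|complex.Im z|)%:C; first exact: dC.
move=> y; rewrite /ball_ /= normC_normc ltcR => zy; apply/orP; right.
have := le_lt_trans (normc_Im (z - y)) zy; rewrite ImB.
by apply: contraTneq => ->; rewrite subr0 ltxx.
Qed.

(* For y near z, clog y = clog z - Lam [:: xa] (1 - y / z): the exponentials
   agree, and the imaginary part stays in ]-pi, pi[. *)
Lemma is_derive_clog z : slit z -> is_derive z (1 : C) (@clog R) z^-1.
Proof.
move=> sz; have z0 := slit_neq0 sz.
pose q y : C := 1 - y / z.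
have dq : is_derive z (1 : C) q (- z^-1).
  have := is_deriveB (is_derive_cst (1 : C) z (1 : C)) (is_deriveZc z^-1 (is_derive_id z (1 : C))).
  rewrite sub0r mulr1; apply: near_eq_is_derive; near=> y.
  by rewrite /q mulrC.
have qz : q z = 0 by rewrite /q mulfV ?subrr.
have d0 := Lam_a_derive0; rewrite -qz in d0.
have dL := is_derive_compc dq d0; rewrite mulr1 in dL.
have := is_deriveB (is_derive_cst (clog z) z (1 : C)) dL; rewrite sub0r opprK.
apply: near_eq_is_derive.
have qc : q y @[y --> z] --> (0 : C) by rewrite -qz; exact: is_derive_continuous dq.
have Lc : (Lam [:: xa] \o q) y @[y --> z] --> (0 : C).
  have := is_derive_continuous dL; rewrite /= qz (Lam0 R [::] xa); exact.
have /andP[a1 a2] := slit_arg sz.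
have e0 : 0 < Num.min (pi - arg z) (pi + arg z).
  by rewrite lt_min; apply/andP; split; lra.
move/ccvgP: qc => /(_ 1 ltr01) q1; move/ccvgP: Lc => /(_ _ e0) L1.
near=> y.
have y1 : normc (q y) < 1 by rewrite -normcN -sub0r; near: y.
have y2 : normc (Lam [:: xa] (q y)) < Num.min (pi - arg z) (pi + arg z).
  by rewrite -normcN -sub0r; near: y.
have yE : cexp (clog z - Lam [:: xa] (q y)) = y.
  rewrite cexpD cexp_clog // cexp_Lam_a // /q opprB addrC subrK mulrC divfK //.
rewrite -[in RHS]yE clog_cexp // ImB /=.
move: y2; rewrite lt_min => /andP[y2 y3].
have := le_lt_trans (normc_Im _) y2; have := le_lt_trans (normc_Im _) y3.
by rewrite !ltr_norml; lra.
Unshelve. all: by end_near. Qed.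

Lemma clogV z : 0 < complex.Re z -> clog z^-1 = - clog z.
Proof.
move=> x0; have sz : slit z by rewrite /slit x0.
have /andP[a1 a2] := slit_arg sz.
have E : cexp (- clog z) = z^-1.
  apply: (mulfI (slit_neq0 sz)); rewrite mulfV ?slit_neq0 //.
  by rewrite -{1}(cexp_clog (slit_neq0 sz)) cexpN.
by rewrite -E clog_cexp //= ltrN2 a2 lerNl ltW.
Qed.

End Logarithm.

(** * The morphism L *)

Section Polylog.
Variable R : realType.
Notation C := (R[i])^o.
Implicit Types (z w : C).

Lemma Re_1B_gt0 z : normc z < 1 -> 0 < complex.Re (1 - z).
Proof.
move=> z1; rewrite ReB /= subr_gt0; apply: le_lt_trans z1.
by apply: le_trans (normc_Re z); exact: ler_norm.
Qed.

Lemma clog1 : clog (1 : C) = 0.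
Proof.
have pi0 := pi_gt0 R.
by rewrite -[X in clog X](cexp0 R) clog_cexp //= ltW // andbT oppr_lt0.
Qed.

Lemma Lam_a_clog w : normc w < 1 -> Lam [:: xa] w = - clog (1 - w).
Proof.
move=> w1; apply/eqP; rewrite -addr_eq0; apply/eqP.
pose g z := Lam [:: xa] z + clog (1 - z) : C.
suff : g w = g 0 by rewrite /g subr0 clog1 (Lam0 R [::] xa) addr0.
apply: disc_const w1 => z z1.
have sz : slit (1 - z) by rewrite /slit Re_1B_gt0.
have dc := is_derive_compc (is_derive_1B z) (is_derive_clog sz).
apply: (is_derive_eq (is_deriveD (is_derive_Lam_a z1) dc)).
by rewrite mulN1r subrr.
Qed.

Lemma OmegaP z : Omega z <-> normc z < 1 /\ slit z.
Proof.
have nE : (unit_disk z : Prop) = (normc z < 1).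
  by rewrite /unit_disk /= normC_normc -[1]/(1%:C) ltcR.
rewrite /Omega /= /setD /= nE; split=> [[z1 zs]|[z1 sz]].
  split=> //; rewrite /slit; case: ltP => //= x0; apply/eqP => y0; apply: zs.
  exists (complex.Re z); last by apply: complexP.
  rewrite /= in_itv /= x0 andbT; have := le_lt_trans (normc_Re z) z1.
  by rewrite ltr_norml => /andP[].
split=> // -[x] /=; rewrite in_itv /= => /andP[_ x0] zx; move: sz.
by rewrite -zx /slit /= eqxx orbF ltNge x0.
Qed.

Lemma Omega_near z : Omega z -> \forall y \near (z : C), Omega y.
Proof.
move=> /OmegaP[z1 sz]; have y1 : \forall y \near (z : C), normc y < 1.
  have d0 : 0 < 1 - normc z by rewrite subr_gt0.
  have dC : (0 : R[i]) < (1 - normc z)%:C by rewrite -[0]/(0%:C) ltcR.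
  exists (1 - normc z)%:C; first exact: dC.
  move=> y; rewrite /ball_ /= normC_normc ltcR => zy.
  by rewrite -(subrK z y); apply: le_lt_trans (normcD _ _) _; rewrite normc_distC; lra.
apply: filterS2 y1 (slit_near sz) => y y1 ys; exact/OmegaP.
Qed.

Lemma is_derive_near (f g : C -> C) z (l : C) :
  (\forall y \near z, f y = g y) -> is_derive z (1 : C) f l -> is_derive z (1 : C) g l.
Proof. by move=> fg; apply: near_eq_is_derive. Qed.

(** The morphism is chosen separately at each z, so holomorphy in z has to be recovered: it holds on
    Wp and at b, where the values are forced, and spreads to H by generation. Near a point of Omega
    all values are forced because Omega is open. *)
Lemma polylog_exists : exists L : H -> C -> C, is_polylog L.
Proof.
have /choice[f fP] z : exists f : H -> R[i], Omega z ->
    [/\ alg_morphism f, forall w : word, Wp w -> f (wd w) = Lam w z & f (wd [:: xb]) = clog z].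
  have [/OmegaP[z1 sz]|] := pselect (Omega z); last by exists (fun=> 0).
  have [f fP] := morphism_extension (phi := (@Lam R)^~ z) (clog z) (Lam_nil z)
    (fun u v up vp => Lam_mul up vp z1).
  by exists f.
exists (fun h z => f z h); split.
- suff : forall h, forall z, Omega z -> exists l : C, is_derive z (1 : C) (fun z => f z h : C) l.
    by move=> fd h z /(fd h)[l []].
  apply: generation_Wp.
  + move=> z Oz; exists 0.
    apply: is_derive_near (is_derive_cst (0 : C) z (1 : C)).
    apply: filterS (Omega_near Oz) => y Oy; rewrite (qlinear0 (f := f y)) //.
    by have [[]] := fP y Oy.
  + move=> q x y dx dy z Oz; have [lx dlx] := dx z Oz; have [ly dly] := dy z Oz.
    exists (ratr q * lx + ly).
    apply: is_derive_near (is_deriveD (is_deriveZc (ratr q) dlx) dly).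
    apply: filterS (Omega_near Oz) => t Ot /=.
    by have [[_ fl _]] := fP t Ot; rewrite fl.
  + move=> w ww z Oz; have /OmegaP[z1 _] := Oz; eexists.
    apply: is_derive_near (Lam_derivable w z1).
    by apply: filterS (Omega_near Oz) => t Ot; have [_ fw _] := fP t Ot; rewrite fw.
  + move=> y dy z Oz; have [ly dly] := dy z Oz; have /OmegaP[_ sz] := Oz; eexists.
    apply: is_derive_near (is_deriveMc (is_derive_clog sz) dly).
    by apply: filterS (Omega_near Oz) => t Ot; have [[_ _ fM] _ fb] := fP t Ot; rewrite fM fb.
- by move=> z /fP[].
- by move=> w ww z Oz; have [_ fw _] := fP z Oz; rewrite fw // Li_Lam.
- by move=> z /fP[].
Qed.

Lemma polylogP : is_polylog (@polylog R).
Proof. by have [L LP] := polylog_exists; exact: (xgetPex _ (ex_intro _ L LP)). Qed.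

Lemma polylog_morphism z : Omega z -> alg_morphism (fun h => polylog h z).
Proof. by have [_ pm _ _] := polylogP; exact: pm. Qed.

Lemma polylog_Wp (w : word) z : Omega z -> Wp w -> polylog (wd w) z = Lam w z.
Proof. by move=> Oz ww; have [_ _ pw _] := polylogP; rewrite pw // Li_Lam. Qed.

Lemma polylog_b z : Omega z -> polylog (wd [:: xb]) z = clog z.
Proof. by have [_ _ _ pb] := polylogP; exact: pb. Qed.

End Polylog.

(** * Constancy along a path to 1 *)

Section Transport.
Variables (R : realType) (phi : letter -> seq (rat * letter)).
Notation C := (R[i])^o.
Hypothesis phi_b : forall q, q \in phi xb -> q.2 = xa.
Implicit Types (z : C) (w y pre : word) (T : C -> C).

(** The last letter of y, which is b, is substituted and put in front; by [phi_b] it becomes a. *)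
Lemma subst_word_Wp y : last xb y != xa -> forall p, p \in subst_word phi y ->
  Wp p.2 /\ (y != [::] -> p.2 != [::]).
Proof.
elim: y => [|c y IHy] ly p /=; first by rewrite inE => /eqP ->.
move=> /allpairsP[[q p'] /= [qc p'y ->]] /=; split; last by case: (p'.2).
case: y ly p'y IHy => [|d y] ly p'y IHy.
  move: p'y ly qc; rewrite inE => /eqP -> /=; case: c => // _ /phi_b ->.
  by [].
by have [w0 w1] := IHy ly _ p'y; apply: Wp_rcons => //; exact: w1.
Qed.

Lemma subst_word_rcons_Wp c y q p : last xb (c :: y) != xa -> q \in phi c ->
  p \in subst_word phi y -> Wp (rcons p.2 q.2).
Proof.
move=> ly qc py.
have : ((p.1 * q.1, rcons p.2 q.2) : rat * word) \in subst_word phi (c :: y).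
  by apply/allpairsP; exists (q, p).
by move=> /(subst_word_Wp ly)[].
Qed.

Lemma cvg_seq_unique (u : nat -> C) (a b : C) :
  u @ \oo --> a -> u @ \oo --> b -> a = b.
Proof.
by move=> ua ub; have <- := cvg_lim (@norm_hausdorff _ C) ua; exact: cvg_lim.
Qed.

Definition LamT T y z : C := subst_fun phi (fun w => Lam w (T z)) y.

Lemma LamT_nil T z : LamT T [::] z = 1.
Proof. by rewrite /LamT /subst_fun big_seq1 rmorph1 mul1r Lam_nil. Qed.

Lemma is_derive_LamT T (T' : C) c y z : last xb (c :: y) != xa ->
  normc (T z) < 1 -> T z != 0 -> is_derive z (1 : C) T T' ->
  is_derive z (1 : C) (LamT T (c :: y))
    (T' * (\sum_(q <- phi c) ratr q.1 * omega q.2 (T z)) * LamT T y z).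
Proof.
move=> ly T1 T0 dT.
have -> : LamT T (c :: y) = fun z => \sum_(q <- phi c) ratr q.1 *
    \sum_(p <- subst_word phi y) ratr p.1 * Lam (rcons p.2 q.2) (T z).
  by apply/funext => x; rewrite /LamT subst_fun_cons.
have -> : T' * (\sum_(q <- phi c) ratr q.1 * omega q.2 (T z)) * LamT T y z =
    \sum_(q <- phi c) ratr q.1 * \sum_(p <- subst_word phi y)
      ratr p.1 * (T' * (omega q.2 (T z) * Lam p.2 (T z))).
  rewrite [T' * _]mulr_sumr [LHS]mulr_suml; apply: eq_bigr => q _.
  rewrite /LamT /subst_fun !mulr_sumr; apply: eq_bigr => p _; ring.
apply: is_derive_bigsum => q qc; apply: is_deriveZc.
apply: is_derive_bigsum => p py; apply: is_deriveZc.
apply: (is_derive_compc (f := T)) dT _.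
exact: is_derive_Lam T1 T0 (subst_word_rcons_Wp ly qc py).
Qed.

(** With [pre] empty this is F_w(z). In general it keeps the cuts of [pre ++ w] that are not inside
    [pre], so that an induction can move letters from w to [pre]. *)
Definition Fsum T pre w z : C := \sum_(p <- splits w) Lam (pre ++ p.1) z * LamT T p.2 z.

Lemma Fsum_nil T pre z : Fsum T pre [::] z = Lam pre z.
Proof. by rewrite /Fsum big_seq1 cats0 LamT_nil mulr1. Qed.

Lemma Fsum_cons T pre c w z :
  Fsum T pre (c :: w) z = Lam pre z * LamT T (c :: w) z + Fsum T (rcons pre c) w z.
Proof.
rewrite /Fsum (sum_splits_cons c w (fun x y => Lam (pre ++ x) z * LamT T y z)) cats0.
by congr (_ + _); apply: eq_bigr => p _; rewrite cat_rcons.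
Qed.

(* By ode, differentiating the second factor at the cut before c cancels
   differentiating the first factor at the cut after c. *)
Lemma is_derive_Fsum T (T' : C) pre w z (D : C) :
  normc z < 1 -> z != 0 -> normc (T z) < 1 -> T z != 0 ->
  is_derive z (1 : C) T T' ->
  (forall c, T' * (\sum_(q <- phi c) ratr q.1 * omega q.2 (T z)) = - omega c z) ->
  Wp (pre ++ w) -> last xb w != xa ->
  is_derive z (1 : C) (@Lam R pre) D ->
  is_derive z (1 : C) (Fsum T pre w) (D * LamT T w z).
Proof.
move=> z1 z0 T1 T0 dT ode.
elim: w pre D => [|c w IHw] pre D wp lw dL.
  have -> : Fsum T pre [::] = @Lam R pre by apply/funext => x; rewrite Fsum_nil.
  by rewrite LamT_nil mulr1.
have -> : Fsum T pre (c :: w) =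
    (fun x => Lam pre x * LamT T (c :: w) x) \+ Fsum T (rcons pre c) w.
  by apply/funext => x; rewrite Fsum_cons.
have lw' : last xb w != xa by move: lw; case: (w) => //; case: (c).
have pcw : Wp (rcons pre c ++ w) by rewrite cat_rcons.
have pc : Wp (rcons pre c) by move: pcw; case: (pre).
have d1 := IHw _ _ pcw lw' (is_derive_Lam z1 z0 pc).
have d2 := is_deriveMc dL (is_derive_LamT lw T1 T0 dT).
by apply: (is_derive_eq (is_deriveD d2 d1)); rewrite ode; ring.
Qed.

Lemma cvg_Lam_quot w (y : nat -> C) : Wp w -> w != [::] ->
  y @ \oo --> (0 : C) -> (forall k, y k != 0) ->
  exists l : C, (y k)^-1 * Lam w (y k) @[k --> \oo] --> l.
Proof.
case/lastP: w => // w c _ _ y0 yn0.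
have n0 : normc (0 : C) < 1 by rewrite normc0.
have /is_deriveP d0 := Lam_derivable (rcons w c) n0.
have y0' : y @ \oo --> (0 : C)^'.
  move=> A A0; have h : \forall k \near \oo, (y k != 0 -> A (y k)) := y0 _ A0.
  change (\forall k \near \oo, A (y k)).
  by apply: filterS h => k /(_ (yn0 k)).
exists (pser (dpser (lcoef R (rcons w c))) 0).
have -> : (fun k => (y k)^-1 * Lam (rcons w c) (y k)) =
    (fun h : C => h^-1 * (Lam (rcons w c) (0 + h) - Lam (rcons w c) 0)) \o y.
  by apply/funext => k /=; rewrite add0r (Lam0 R w c) subr0.
exact: (cvg_comp _ _ y0' d0).
Qed.

Lemma cvg_LamT T (t : C) y (x : nat -> C) : y != [::] -> last xb y != xa ->
  (forall k, T (x k) != 0) -> T (x k) @[k --> \oo] --> (0 : C) ->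
  T (x k) / (1 - x k) @[k --> \oo] --> t ->
  exists l : C, LamT T y (x k) / (1 - x k) @[k --> \oo] --> l.
Proof.
move=> y0 ly T0 Tx Tt.
have : forall p, p \in subst_word phi y -> Wp p.2 /\ p.2 != [::].
  by move=> p /(subst_word_Wp ly)[pw /(_ y0)].
rewrite /LamT /subst_fun; elim: (subst_word phi y) => [_|p s IHs sp].
  by exists 0; under eq_fun do rewrite big_nil mul0r; exact: cvg_cst.
have [l ls] := IHs (fun q qs => sp q (mem_behead (s := p :: s) qs)).
have [pw p0] := sp p (mem_head _ _).
have [m mp] := cvg_Lam_quot pw p0 Tx T0.
exists (ratr p.1 * (m * t) + l).
have -> : (fun k => (\sum_(q <- p :: s) ratr q.1 * Lam q.2 (T (x k))) / (1 - x k)) =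
   (fun k => ratr p.1 * (((T (x k))^-1 * Lam p.2 (T (x k))) * (T (x k) / (1 - x k))) +
     (\sum_(q <- s) ratr q.1 * Lam q.2 (T (x k))) / (1 - x k)).
  apply/funext => k; rewrite big_cons mulrDl; congr (_ + _).
  by rewrite -mulrA; congr (_ * _); rewrite mulrACA mulVf ?mul1r ?T0.
exact: (cvgD (cvgM (cvg_cst (ratr p.1 : C)) (cvgM mp Tt)) ls).
Qed.

Lemma cvg_Fsum T (t : C) pre w (x : nat -> C) :
  (forall k, normc (x k) < 1) -> x @ \oo --> (1 : C) ->
  (forall k, T (x k) != 0) -> T (x k) @[k --> \oo] --> (0 : C) ->
  T (x k) / (1 - x k) @[k --> \oo] --> t ->
  last xb (pre ++ w) != xa ->
  Fsum T pre w (x k) @[k --> \oo] --> (Lam (pre ++ w) 1 : C).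
Proof.
move=> x1 xc T0 Tx Tt; have x1' : \forall k \near \oo, normc (x k) < 1 by exact: nearW.
elim: w pre => [|c w IHw] pre.
  rewrite cats0; under eq_fun do rewrite Fsum_nil.
  case/lastP: pre => [_|u c].
    by rewrite Lam_nil; under eq_fun do rewrite Lam_nil; exact: cvg_cst.
  rewrite last_rcons; case: c => [/eqP ac|_]; first by exfalso.
  exact: (@cvg_Lam_b R nat \oo _ u x x1' xc).
move=> lw; have ly : last xb (c :: w) != xa by move: lw; rewrite last_cat.
have [l lT] := cvg_LamT (y := c :: w) isT ly T0 Tx Tt.
have c0 : (1 - x k) * Lam pre (x k) @[k --> \oo] --> (0 : C).
  exact: (@cvg_mul_Lam R nat \oo _ pre x x1' xc).
have c0l : ((1 - x k) * Lam pre (x k)) * (LamT T (c :: w) (x k) / (1 - x k))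
    @[k --> \oo] --> (0 : C).
  by rewrite -[X in _ --> X](mul0r l); exact: (cvgM c0 lT).
have := IHw (rcons pre c); rewrite cat_rcons => /(_ lw) c1.
rewrite -[X in _ --> X]add0r.
have -> : (fun k => Fsum T pre (c :: w) (x k)) =
  (fun k => ((1 - x k) * Lam pre (x k)) * (LamT T (c :: w) (x k) / (1 - x k)) +
     Fsum T (rcons pre c) w (x k)).
  apply/funext => k; rewrite Fsum_cons; congr (_ + _).
  have n0 := normc_lt1_neq1 (x1 k).
  by rewrite (mulrC (1 - x k)) -mulrA; congr (_ * _); rewrite mulrCA mulfV ?mulr1.
exact: (cvgD c0l c1).
Qed.

(** F_w is constant on the half-open segment from p to 1, so its value at p is its limit along the
    points 1 - (1 - p)/(k + 1). *)
Lemma Fsum_Lam1 T (T' : C -> C) (t p : C) w :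
  (forall s : R, 0 < s <= 1 -> let z : C := 1 - s%:C * (1 - p) in
    [/\ normc z < 1, z != 0, normc (T z) < 1, T z != 0 & is_derive z (1 : C) T (T' z)]) ->
  (forall (z : C) c, z != 0 -> 1 - z != 0 ->
    T' z * (\sum_(q <- phi c) ratr q.1 * omega q.2 (T z)) = - omega c z) ->
  (forall x : nat -> C, x @ \oo --> (1 : C) -> (forall k, x k != 0) ->
    (forall k, 1 - x k != 0) ->
    T (x k) @[k --> \oo] --> (0 : C) /\ T (x k) / (1 - x k) @[k --> \oo] --> t) ->
  Wpp w -> Fsum T [::] w p = Lam w 1.
Proof.
move=> seg ode lim /andP[wp lw].
pose x k : C := 1 - (k.+1%:R^-1)%:C * (1 - p).
have k01 k : 0 < (k.+1%:R^-1 : R) <= 1 by rewrite invr_gt0 ltr0n /= invf_le1 ?ltr0n // ler1n.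
have x1 k : normc (x k) < 1 by have [] := seg _ (k01 k).
have x0 k : x k != 0 by have [] := seg _ (k01 k).
have T0 k : T (x k) != 0 by have [] := seg _ (k01 k).
have hc : (k.+1%:R^-1)%:C @[k --> \oo] --> (0 : C).
  by apply: cvg_complex => /=; [exact: cvg_harmonic|exact: cvg_cst].
have xc : x @ \oo --> (1 - 0 * (1 - p) : C).
  exact: (cvgB (cvg_cst (1 : C)) (cvgM hc (cvg_cst (1 - p : C)))).
have e1 : 1 - 0 * (1 - p) = 1 :> C by rewrite mul0r subr0.
rewrite e1 in xc.
have [Tx Tt] := lim x xc x0 (fun k => normc_lt1_neq1 (x1 k)).
have lw' : last xb ([::] ++ w) != xa by exact: lw.
have Fc := cvg_Fsum (pre := [::]) (w := w) x1 xc T0 Tx Tt lw'.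
have Fx k : Fsum T [::] w (x k) = Fsum T [::] w p.
  (* The segment from p to [x k] lies inside the one covered by [seg]. *)
  have sg (r : R) : 0 <= r <= 1 -> exists2 s : R, 0 < s <= 1 &
      p + r%:C * (x k - p) = 1 - s%:C * (1 - p).
    move=> /andP[r0 r1]; exists (1 - r + r * k.+1%:R^-1).
      move: (k.+1%:R^-1) (k01 k) => m /andP[m0 m1]; apply/andP; split; last by nra.
      have rk : 0 <= r * m by rewrite mulr_ge0 // ltW.
      by move: (r1); rewrite le_eqVlt => /predU1P[->|r1']; [rewrite subrr add0r mul1r|lra].
    rewrite /x rmorphD rmorphB rmorphM rmorph1 /=; ring.
  rewrite -[x k](subrK p) addrC.
  have dF (r : R) : 0 <= r <= 1 ->
      is_derive (p + r%:C * (x k - p) : C) (1 : C) (Fsum T [::] w) 0.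
    move=> /sg[s s01 ->]; have [z1 z0 T1 T0' dT] := seg s s01.
    have d0 : is_derive (1 - s%:C * (1 - p) : C) (1 : C) (@Lam R [::]) 0.
      have -> : @Lam R [::] = cst 1 by apply/funext => y; rewrite Lam_nil.
      exact: is_derive_cst.
    have wp' : Wp ([::] ++ w) by exact: wp.
    have := is_derive_Fsum z1 z0 T1 T0' dT (fun c => ode _ c z0 (normc_lt1_neq1 z1)) wp' lw d0.
    by rewrite mul0r.
  apply: segment_const => r r01; first by apply: dF; case/andP: r01 => /ltW -> /ltW ->.
  exact: is_derive_continuous (dF r r01).
have Fc' : (fun k => Fsum T [::] w (x k)) = cst (Fsum T [::] w p).
  by apply/funext => k; rewrite Fx.
rewrite Fc' in Fc; apply/esym.
exact: (cvg_seq_unique Fc (cvg_cst _)).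
Qed.

End Transport.

Lemma mem_splits (w : word) p : p \in splits w -> p.1 ++ p.2 = w.
Proof.
elim: w p => [|c w IHw] p /=; first by rewrite inE => /eqP ->.
by rewrite inE => /orP[/eqP -> //|/mapP[q /IHw <- ->]].
Qed.

(** The candidate f serves twice: it makes the description nonvacuous, and it agrees with the chosen
    map on generators. *)
Lemma zeta_regP (R : realType) (v : (R[i])^o) f : is_zeta v f -> zeta_reg v =1 f.
Proof.
move=> fz; have [gm gw gb ga] : is_zeta v (zeta_reg v) by exact: (xgetPex _ (ex_intro _ f fz)).
have [fm fw fb fa] := fz.
apply: (alg_morphism_Wpp_inj (F := R[i])); [exact: gm|exact: fm| | |].
- by move=> w ww; rewrite gw // fw.
- by rewrite ga fa.
- by rewrite gb fb.
Qed.

(** * Regularised zeta values as values of L *)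

Section Twisted.
Variables (R : realType) (phi : letter -> seq (rat * letter)).
Notation C := (R[i])^o.
Implicit Types (z y : C) (T : C -> C).

(** The two points are kept apart: the constancy argument gives the pair (z, T z), whereas [twist]
    requires (z, z). They coincide at 1/2, but for tau only in the limit. *)
Definition twisted z y : word -> C :=
  convol (fun w => polylog (wd w) z) (subst_fun phi (fun w => polylog (wd w) y)).

Lemma twisted_morphism z y : Omega z -> Omega y ->
  word_morphism (F := R[i]) (twisted z y).
Proof.
move=> Oz Oy; have zm := word_morphismP (polylog_morphism Oz).
have ym := word_morphismP (polylog_morphism Oy).
exact: (convol_morphism zm (subst_fun_morphism phi ym)).
Qed.

Lemma polylog_twist z h : Omega z ->
  polylog (twist phi h) z = qext (F := R[i]) (twisted z z) h.
Proof. by move=> Oz; exact: (alg_morphism_twist phi h (polylog_morphism Oz)). Qed.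

Lemma polylog_nil z : Omega z -> polylog (wd [::]) z = 1.
Proof. by move=> Oz; have [] := polylog_morphism Oz. Qed.

Lemma twisted_letter z y c : Omega z -> Omega y ->
  twisted z y [:: c] =
  \sum_(q <- phi c) ratr q.1 * polylog (wd [:: q.2]) y + polylog (wd [:: c]) z.
Proof.
move=> Oz Oy; rewrite /twisted /convol /= big_cons big_seq1 /= polylog_nil // mul1r.
rewrite subst_fun_cons [subst_fun _ _ [::]]big_seq1 rmorph1 mul1r polylog_nil // mulr1.
by congr (_ + _); apply: eq_bigr => q _; rewrite [subst_fun _ _ _]big_seq1 rmorph1 mul1r.
Qed.

Hypothesis phi_b : forall q, q \in phi xb -> q.2 = xa.

Lemma twisted_Wpp T z w : Omega z -> Omega (T z) -> Wpp w ->
  twisted z (T z) w = Fsum phi T [::] w z.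
Proof.
move=> Oz OT /andP[wp lw]; apply: eq_big_seq => p /mem_splits pw.
have p1 : Wp p.1 by move: wp; rewrite -pw; case: (p.1).
have p2 : last xb p.2 != xa.
  by move: lw; rewrite -pw last_cat; case: (p.2).
rewrite polylog_Wp //; congr (_ * _); apply: eq_big_seq => q qs.
by rewrite polylog_Wp //; have [] := subst_word_Wp phi_b p2 qs.
Qed.

Lemma is_zeta_twisted T z (v : C) : Omega z -> Omega (T z) ->
  (forall w, Wpp w -> Fsum phi T [::] w z = Lam w 1) ->
  twisted z (T z) [:: xb] = 0 -> twisted z (T z) [:: xa] = v ->
  zeta_reg v =1 qext (F := R[i]) (twisted z (T z)).
Proof.
move=> Oz OT Fw tb ta; apply: zeta_regP; split.
- exact: (qext_morphism (twisted_morphism Oz OT)).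
- move=> w ww; have /andP[wp _] := ww.
  by rewrite qextU twisted_Wpp // Fw // Li_Lam.
- by rewrite qextU.
- by rewrite qextU.
Qed.

Lemma cvg_bigsum (I : Type) (s : seq I) (f : I -> nat -> C) (l : I -> C) :
  (forall i, f i k @[k --> \oo] --> l i) ->
  \sum_(i <- s) f i k @[k --> \oo] --> \sum_(i <- s) l i.
Proof.
move=> fl; elim: s => [|i s IHs].
  by rewrite big_nil; under eq_fun do rewrite big_nil; exact: cvg_cst.
rewrite big_cons; under eq_fun do rewrite big_cons.
exact: (cvgD (fl i) IHs).
Qed.

(** The limit depends only on [l], so the pairs (z, T z) and (z, z) give the same one when z and T z
    both tend to a fixed point of T. *)
Lemma cvg_twisted (z y : nat -> C) (l : H -> C) h :
  (forall x, polylog x (z k) @[k --> \oo] --> l x) ->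
  (forall x, polylog x (y k) @[k --> \oo] --> l x) ->
  qext (F := R[i]) (twisted (z k) (y k)) h @[k --> \oo] -->
  (qext (F := R[i]) (convol (fun w => l (wd w)) (subst_fun phi (fun w => l (wd w)))) h : C).
Proof.
move=> zl yl; apply: cvg_bigsum => w.
suff tw : twisted (z k) (y k) w @[k --> \oo] -->
    (convol (fun w => l (wd w)) (subst_fun phi (fun w => l (wd w))) w : C).
  exact: (cvgM (cvg_cst (ratr h@_w : C)) tw).
apply: cvg_bigsum => p.
suff sw : subst_fun phi (fun w => polylog (wd w) (y k)) p.2 @[k --> \oo] -->
    (subst_fun phi (fun w => l (wd w)) p.2 : C).
  exact: (cvgM (zl _) sw).
apply: cvg_bigsum => q; exact: (cvgM (cvg_cst (ratr q.1 : C)) (yl _)).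
Qed.

End Twisted.

(** * The substitution sigma and the point 1/2 *)

Section Sigma.
Variable R : realType.
Notation C := (R[i])^o.

Lemma omega_sigma c (z : C) : 
  (-1) * (\sum_(q <- sigma_letter c) ratr q.1 * omega q.2 (1 - z)) = - omega c z.
Proof.
rewrite big_seq1 rmorph1 mul1r mulN1r; congr (- _).
by case: c => /=; rewrite ?subKr.
Qed.

Let half : C := 2^-1.

Lemma half_real : half = (2^-1 : R)%:C.
Proof. by rewrite /half fmorphV rmorph_nat. Qed.

Lemma one_sub_half : 1 - half = half.
Proof.
by rewrite half_real -[1]/((1 : R)%:C) -rmorphB; congr (_%:C); lra.
Qed.

Lemma Omega_half : Omega half.
Proof.
apply/OmegaP; rewrite half_real normc_real ger0_norm ?invr_ge0 // invf_lt1 // ltr1n.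
by split=> //; rewrite /slit /= invr_gt0 ltr0n.
Qed.

Lemma sigma_segment (s : R) : 0 < s <= 1 -> let z : C := 1 - s%:C * (1 - half) in
  [/\ normc z < 1, z != 0, normc (1 - z) < 1, 1 - z != 0 &
      is_derive z (1 : C) (fun z => 1 - z) (-1)].
Proof.
move=> /andP[s0 s1] z.
have zE : z = (1 - s / 2)%:C.
  by rewrite /z one_sub_half half_real -rmorphM -[1]/((1 : R)%:C) -rmorphB.
have z'E : 1 - z = (s / 2)%:C.
  by rewrite zE -[1]/((1 : R)%:C) -rmorphB subKr.
have n0 (x : R) : 0 < x -> (x%:C : C) != 0.
  by move=> x0; rewrite eq_complex /= eqxx andbT gt_eqF.
rewrite z'E; split; last by exact: is_derive_1B.
- by rewrite zE normc_real ger0_norm; lra.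
- by rewrite zE n0 //; lra.
- by rewrite normc_real ger0_norm; lra.
- by rewrite n0 //; lra.
Qed.

Lemma zeta_half h : zeta R h = polylog (square h) (2^-1 : C).
Proof.
rewrite square_twist polylog_twist; last exact: Omega_half.
have phib q : q \in sigma_letter xb -> q.2 = xa by rewrite inE => /eqP ->.
have OT : Omega (1 - half) by rewrite one_sub_half; exact: Omega_half.
have h1 : normc half < 1 by have /OmegaP[] := Omega_half.
rewrite -[X in twisted _ _ X]one_sub_half.
apply: (@is_zeta_twisted R sigma_letter phib (fun z => 1 - z)) => //.
- exact: Omega_half.
- move=> w ww; apply: (Fsum_Lam1 phib (T' := fun=> -1) (t := 1)) ww.
  + exact: sigma_segment.
  + by move=> z c _ _; exact: omega_sigma.
  + move=> x x1 x0 xn1; split.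
      by rewrite -(subrr (1 : C)); exact: (cvgB (cvg_cst (1 : C)) x1).
    by under eq_fun do rewrite mulfV //; exact: cvg_cst.
- rewrite twisted_letter //; last exact: Omega_half.
  rewrite big_seq1 rmorph1 mul1r /= polylog_b ?polylog_Wp //; last exact: Omega_half.
  by rewrite Lam_a_clog ?one_sub_half // addNr.
- rewrite twisted_letter //; last exact: Omega_half.
  rewrite big_seq1 rmorph1 mul1r /= polylog_b ?polylog_Wp //; last exact: Omega_half.
  by rewrite Lam_a_clog ?one_sub_half // addrN.
Qed.

End Sigma.

(** * The substitution tau and the points rho, 1/rho *)

Section Tau.
Variable R : realType.
Notation C := (R[i])^o.
Implicit Types (z : C) (e : R).

Definition tau_map z : C := 1 - z^-1.

Lemma is_derive_tau_map z : z != 0 -> is_derive z (1 : C) tau_map (z ^- 2).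
Proof.
move=> z0; have dV : is_derive z (1 : C) (fun y : C => y^-1) (- (z ^- 2)).
  have di := @derivable_id _ C z 1.
  have d : derivable (fun y : C => y^-1) z 1 by exact: (derivableV (f := id) z0 di).
  apply: DeriveDef d _; rewrite (deriveV (f := id) z0 di) derive_id.
  by rewrite -[_ *: _]/(_ * _) mulr1.
have := is_deriveB (is_derive_cst (1 : C) z (1 : C)) dV.
by rewrite sub0r opprK.
Qed.

Lemma omega_tau c z : z != 0 -> 1 - z != 0 ->
  z ^- 2 * (\sum_(q <- tau_letter c) ratr q.1 * omega q.2 (tau_map z)) = - omega c z.
Proof.
move=> z0 z1; have z1' : z - 1 != 0 by rewrite -opprB oppr_eq0.
have Tz : tau_map z = (z - 1) / z by rewrite /tau_map mulrBl mulfV // mul1r.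
case: c => /=.
  rewrite big_cons big_seq1 rmorph1 !mul1r /= /tau_map subKr invrK -/(tau_map z) Tz invf_div.
  rewrite -[1 - z]opprB invrN opprK; field; by rewrite z1' z0.
rewrite big_seq1 rmorphN rmorph1 /= /tau_map subKr invrK; field; by [].
Qed.

(** Here [e] is a sign. The condition Re z > 1/2 means |z - 1| < |z|, that is |T z| < 1. *)
Definition tau_dom e z := [/\ normc z < 1, 2^-1 < complex.Re z & 0 < e * complex.Im z].

Lemma normc_sqr z : normc z ^+ 2 = complex.Re z ^+ 2 + complex.Im z ^+ 2.
Proof. by case: z => x y; rewrite /= sqr_sqrtr // addr_ge0 ?sqr_ge0. Qed.

Lemma tau_map_dom e z : tau_dom e z ->
  [/\ normc (tau_map z) < 1, tau_map z != 0 & 0 < e * complex.Im (tau_map z)].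
Proof.
move=> [z1 rz iz]; have z0 : z != 0.
  by apply: contraTneq rz => ->; rewrite /= -leNgt invr_ge0.
have nz : 0 < normc z by rewrite normc_gt0.
have Tz : tau_map z = (z - 1) / z by rewrite /tau_map mulrBl mulfV // mul1r.
have n1 : normc (tau_map z) < 1.
  rewrite Tz normcM normcV ltr_pdivrMr // mul1r.
  rewrite -(ltr_pXn2r (n := 2)) ?nnegrE ?normc_ge0 // !normc_sqr ReB ImB /=; nra.
have im : 0 < e * complex.Im (tau_map z).
  have -> : complex.Im (tau_map z) = complex.Im z / normc z ^+ 2.
    rewrite normc_sqr /tau_map ImB; case: (z) => x y /=.
    by rewrite sub0r opprK.
  by rewrite mulrA divr_gt0 // exprn_gt0.
split=> //; by apply: contraTneq im => ->; rewrite /= mulr0 ltxx.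
Qed.

Lemma Omega_Im e z : normc z < 1 -> 0 < e * complex.Im z -> Omega z.
Proof.
move=> z1 iz; apply/OmegaP; split=> //; rewrite /slit; apply/orP; right.
by apply: contraTneq iz => ->; rewrite mulr0 ltxx.
Qed.

Lemma tau_dom_Omega e z : tau_dom e z -> Omega z /\ Omega (tau_map z).
Proof.
move=> ez; have [T1 _ iT] := tau_map_dom ez; have [z1 _ iz] := ez.
by split; [exact: Omega_Im z1 iz|exact: Omega_Im T1 iT].
Qed.

Lemma arg_right z : 0 < complex.Re z -> - (pi / 2) < arg z < pi / 2.
Proof.
move=> rz; have sz : slit z by rewrite /slit rz.
have /andP[a1 a2] := slit_arg sz; have z0 := slit_neq0 sz.
have : 0 < cos (arg z).
  by move: rz; rewrite (Re_polar z0) pmulr_rgt0 // normc_gt0.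
move: (arg z) a1 a2 => a a1 a2 ca; have pi0 := pi_gt0 R.
have H (b : R) : cos b = cos a -> b < pi -> b < pi / 2.
  move=> ba bpi; rewrite ltNge; apply/negP => pb.
  have : 0 <= sin (b - pi / 2) by rewrite sin_ge0_pi //; apply/andP; split; lra.
  by rewrite sinBpihalf ba; lra.
have := H a erefl a2; have := H (- a) (cosN a); lra.
Qed.

Lemma arg_sign e z : z != 0 -> slit z -> 0 < e * complex.Im z -> 0 < e * arg z.
Proof.
move=> z0 sz; have /andP[a1 a2] := slit_arg sz.
rewrite (Im_polar z0) mulrCA pmulr_rgt0 ?normc_gt0 //.
move: (arg z) a1 a2 => a a1 a2; have pi0 := pi_gt0 R.
have H (b : R) : - pi < b -> b <= 0 -> sin b <= 0.
  move=> b1 b2; rewrite -oppr_ge0 -sinN sin_ge0_pi //; apply/andP; split; lra.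
have K (b : R) : 0 <= b -> b < pi -> 0 <= sin b.
  by move=> b1 b2; rewrite sin_ge0_pi // b1 ltW.
case: (ltrgtP a 0) => a0; last by rewrite a0 sin0 mulr0 ltxx.
  have := H a a1 (ltW a0) => s0 es0; rewrite nmulr_lgt0 //.
  by rewrite ltNge; apply/negP => e0; nra.
have := K a (ltW a0) a2 => s0 es0; rewrite pmulr_lgt0 //.
by rewrite ltNge; apply/negP => e0; nra.
Qed.

(** Both sides have the same exponential, as 1 - 1/z = - (1 - z)/z. The arguments of z and 1 - z
    have opposite signs and modulus below pi/2, so that of the quotient, multiplied by e, lies in
    ]-pi, 0[, and e pi brings the sum back to the principal range. *)
Lemma clog_tau_map e z : e = 1 \/ e = -1 -> tau_dom e z ->
  clog (tau_map z) = clog (1 - z) - clog z + Complex 0 (e * pi).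
Proof.
move=> e1 ez; have [z1 rz iz] := ez; have pi0 := pi_gt0 R.
have rz0 : 0 < complex.Re z by apply: lt_trans rz; rewrite invr_gt0.
have sz : slit z by rewrite /slit rz0.
have r1 := Re_1B_gt0 z1; have s1 : slit (1 - z) by rewrite /slit r1.
have i1 : 0 < (- e) * complex.Im (1 - z) by rewrite ImB /= sub0r mulrNN.
have a1 := arg_sign (slit_neq0 sz) sz iz.
have a2 := arg_sign (slit_neq0 s1) s1 i1.
have /andP[b1 b2] := arg_right rz0; have /andP[c1 c2] := arg_right r1.
set y := (X in _ = X).
have -> : tau_map z = cexp y.
  have Vz : cexp (- clog z) = z^-1.
    apply: (mulfI (slit_neq0 sz)); rewrite mulfV ?slit_neq0 //.
    by rewrite -{1}(cexp_clog (slit_neq0 sz)) cexpN.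
  have Npi : cexp (Complex 0 (e * pi)) = -1 :> C.
    apply: complexP; rewrite ?Re_cexp ?Im_cexp /= expR0 mul1r.
      by case: e1 => ->; rewrite ?mul1r ?mulN1r ?cosN cospi.
    by case: e1 => ->; rewrite ?mul1r ?mulN1r ?sinN sinpi ?oppr0.
  rewrite /y !cexpD Npi Vz (cexp_clog (slit_neq0 s1)) mulrN1 -mulNr opprB mulrBl.
  by rewrite mulfV ?slit_neq0 // mul1r.
apply: clog_cexp; rewrite /y ImD ImB /=.
by case: e1 a1 a2 => -> a1 a2; apply/andP; split; lra.
Qed.

Lemma tau_segment e z (s : R) : tau_dom e z -> 0 < s <= 1 ->
  tau_dom e (1 - s%:C * (1 - z)).
Proof.
move=> [z1 rz iz] /andP[s0 s1]; have E : 1 - s%:C * (1 - z) = (1 - s)%:C + s%:C * z.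
  by rewrite rmorphB rmorph1 mulrBr mulr1 opprB addrA addrAC.
have hRe : complex.Re (s%:C * z) = s * complex.Re z.
  by case: (z) => x y /=; rewrite mul0r subr0.
have hIm : complex.Im (s%:C * z) = s * complex.Im z.
  by case: (z) => x y /=; rewrite mul0r addr0.
rewrite E; split.
- apply: le_lt_trans (normcD _ _) _; rewrite normcM !normc_real !ger0_norm ?(ltW s0) ?subr_ge0 //.
  by nra.
- by rewrite ReD hRe /=; have := le_lt_trans (ler_norm _) (le_lt_trans (normc_Re z) z1); nra.
- by rewrite ImD hIm /= add0r mulrCA mulr_gt0.
Qed.

Lemma zeta_reg_tau e z h : e = 1 \/ e = -1 -> tau_dom e z ->
  zeta_reg (Complex 0 (e * pi)) h =
  qext (F := R[i]) (twisted tau_letter z (tau_map z)) h.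
Proof.
move=> e1 ez; have [Oz OT] := tau_dom_Omega ez.
have phib q : q \in tau_letter xb -> q.2 = xa by rewrite inE => /eqP ->.
have [z1 rz _] := ez; have [T1 _ _] := tau_map_dom ez.
have rz0 : 0 < complex.Re z by apply: lt_trans rz; rewrite invr_gt0.
have TV : 1 - tau_map z = z^-1 by rewrite /tau_map subKr.
apply: (@is_zeta_twisted R tau_letter phib tau_map) => //.
(* The value [t = -1] is the limit of T z/(1 - z) = -1/z. *)
- move=> w ww; apply: (Fsum_Lam1 phib (T' := fun z => z ^- 2) (t := -1)) ww.
  + move=> s s01 y; have ey : tau_dom e y by exact: tau_segment.
    have [y1 ry _] := ey; have [Ty1 Ty0 _] := tau_map_dom ey.
    have y0 : y != 0 by apply: contraTneq ry => ->; rewrite /= -leNgt invr_ge0.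
    by split=> //; exact: is_derive_tau_map.
  + by move=> y c y0 y1; exact: omega_tau.
  + move=> x x1 x0 xn1; have n10 : (1 : C) != 0 by exact: oner_neq0.
    have xV : (x k)^-1 @[k --> \oo] --> (1^-1 : C) by exact: (cvgV n10 x1).
    split.
      rewrite -(subrr (1 : C)) -[X in _ --> _ - X]invr1.
      exact: (cvgB (cvg_cst (1 : C)) xV).
    have -> : (fun k => tau_map (x k) / (1 - x k)) = (fun k => - (x k)^-1).
      apply/funext => k; have -> : tau_map (x k) = - ((1 - x k) / x k).
        by rewrite mulrBl mul1r mulfV // opprB.
      by rewrite mulNr mulrAC mulfV // mul1r.
    by rewrite -[X in _ --> - X]invr1; exact: (cvgN xV).
- rewrite twisted_letter // big_seq1 rmorphN rmorph1 mulN1r /= polylog_b ?polylog_Wp //.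
  by rewrite Lam_a_clog // TV clogV // opprK addrC subrr.
(* Since tau(a) = a + b, the value at a is log z + log(1 - 1/z) - log(1 - z), of which only the term
   e i pi survives. *)
- rewrite twisted_letter // big_cons big_seq1 !rmorph1 !mul1r /= polylog_b ?polylog_Wp //.
  rewrite !Lam_a_clog // TV clogV // (clog_tau_map e1 ez) opprK.
  by rewrite addrA addrCA subrr addr0 addrAC subrr add0r.
Qed.

(** By generation: on Wp the limit comes from the summable coefficients of (1 - z) L_w(z), at b from
    the continuity of [clog]. *)
Lemma polylog_limit z0 : normc z0 <= 1 -> z0 != 1 -> slit z0 -> forall h,
  exists l : C, polylog h z @[z --> within (@Omega R) (nbhs z0)] --> l.
Proof.
move=> n0 n1 s0; set F := within _ _.
have FF : Filter F by exact: within_filter.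
have nearO (P : C -> Prop) : (forall z, Omega z -> P z) -> \forall z \near F, P z.
  by move=> PO; rewrite /F near_withinE; apply: nearW => z; exact: PO.
have near_id : id @ F --> z0 by exact: cvg_within.
apply: generation_Wp.
- exists 0; apply: cvg_near_eq (cvg_cst (0 : C)); apply: nearO => z Oz.
  by rewrite (qlinear0 (f := fun h => polylog h z)) //; have [] := polylog_morphism Oz.
- move=> q x y [lx dx] [ly dy]; exists (ratr q * lx + ly).
  apply: cvg_near_eq (cvgD (cvgM (cvg_cst (ratr q : C)) dx) dy); apply: nearO => z Oz /=.
  by have [_ fl _] := polylog_morphism Oz; rewrite fl.
- move=> w ww; exists (pser (dcoef R w) z0 / (1 - z0)).
  have zn : \forall z \near F, normc (id z) < 1 by apply: nearO => z /OmegaP[].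
  apply: cvg_near_eq (@cvg_Lam R C F FF w id z0 n0 n1 zn near_id).
  by apply: nearO => z Oz; rewrite polylog_Wp.
- move=> y [ly dy]; exists (clog z0 * ly).
  have cc : clog z @[z --> F] --> clog z0.
    by apply: cvg_within_filter; exact: is_derive_continuous (is_derive_clog s0).
  apply: cvg_near_eq (cvgM cc dy); apply: nearO => z Oz /=.
  by have [_ _ fM] := polylog_morphism Oz; rewrite fM polylog_b.
Qed.

(** Along points [p k] of the domain tending to r, the pair (p k, T (p k)) gives the constant zeta
    value and the pair (p k, p k) gives L at [nabla h]. As T (p k) also tends to r, the limits
    agree. *)
Lemma zeta_tau_limit e (r : C) h : e = 1 \/ e = -1 -> normc r = 1 ->
  complex.Re r = 2^-1 -> 0 < e * complex.Im r -> tau_map r = r ->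
  extension_value (polylog (nabla h)) r (zeta_reg (Complex 0 (e * pi)) h).
Proof.
move=> e1 nr rr ir Tr.
have r1 : r != 1.
  by apply: contraTneq ir => ->; rewrite /= mulr0 ltxx.
have sr : slit r by rewrite /slit rr invr_gt0 ltr0n.
have r0 := slit_neq0 sr.
have nr1 : normc r <= 1 by rewrite nr.
have /choice[l lP] := polylog_limit nr1 r1 sr.
(* Any point of the domain would do; here |q|^2 = 10/16. The open segment from r to q stays in the
   domain. *)
pose q : C := Complex (3 / 4) (e / 4).
have ee : e * e = 1 by case: e1 => ->; rewrite ?mulrNN mulr1.
have qd : tau_dom e q.
  split.
  - rewrite -(ltr_pXn2r (n := 2)) ?nnegrE ?normc_ge0 // normc_sqr /=; nra.
  - by rewrite /=; lra.
  - by rewrite /=; nra.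
pose p k : C := r + (k.+1%:R^-1)%:C * (q - r).
have pd k : tau_dom e (p k).
  rewrite /p; have : 0 < (k.+1%:R^-1 : R) <= 1.
    by rewrite invr_gt0 ltr0n /= invf_le1 ?ltr0n // ler1n.
  move: (k.+1%:R^-1) => t /andP[t0 t1]; have [q1 rq iq] := qd.
  have hRe : complex.Re (t%:C * (q - r)) = t * (complex.Re q - complex.Re r).
    by rewrite -ReB; case: (q - r) => x y /=; rewrite mul0r subr0.
  have hIm : complex.Im (t%:C * (q - r)) = t * (complex.Im q - complex.Im r).
    by rewrite -ImB; case: (q - r) => x y /=; rewrite mul0r addr0.
  have pE : r + t%:C * (q - r) = (1 - t)%:C * r + t%:C * q.
    by rewrite rmorphB rmorph1 mulrBr mulrBl mul1r addrA addrAC.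
  split.
  - rewrite pE; apply: le_lt_trans (normcD _ _) _.
    rewrite !normcM !normc_real nr !ger0_norm ?(ltW t0) ?subr_ge0 //; nra.
  - rewrite ReD hRe rr; nra.
  - rewrite ImD hIm mulrDr mulrCA mulrBr; nra.
have pr : p @ \oo --> r.
  have hc : (k.+1%:R^-1)%:C @[k --> \oo] --> (0 : C).
    by apply: cvg_complex => /=; [exact: cvg_harmonic|exact: cvg_cst].
  have e0 : r + 0 * (q - r) = r by rewrite mul0r addr0.
  have pr0 : p @ \oo --> (r + 0 * (q - r) : C).
    exact: (cvgD (cvg_cst r) (cvgM hc (cvg_cst (q - r : C)))).
  by rewrite e0 in pr0.
have Tp : tau_map (p k) @[k --> \oo] --> r.
  rewrite -[X in _ --> X]Tr; exact: (cvgB (cvg_cst (1 : C)) (cvgV r0 pr)).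
have lim (x : nat -> C) : (forall k, Omega (x k)) -> x @ \oo --> r ->
    forall y, polylog y (x k) @[k --> \oo] --> l y.
  move=> xO xr y.
  have xw : x @ \oo --> within (@Omega R) (nbhs r).
    move=> A A0; have xA : \forall k \near \oo, (Omega (x k) -> A (x k)) := xr _ A0.
    change (\forall k \near \oo, A (x k)).
    by apply: filterS xA => k /(_ (xO k)).
  exact: (cvg_comp _ _ xw (lP y)).
have lp := lim _ (fun k => (tau_dom_Omega (pd k)).1) pr.
have lT := lim _ (fun k => (tau_dom_Omega (pd k)).2) Tp.
have c1 := cvg_twisted (phi := tau_letter) (h := h) lp lT.
have c2 := cvg_twisted (phi := tau_letter) (h := h) lp lp.
have E1 : (fun k => qext (F := R[i]) (twisted tau_letter (p k) (tau_map (p k))) h) =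
    cst (zeta_reg (Complex 0 (e * pi)) h).
  by apply/funext => k; rewrite (zeta_reg_tau h e1 (pd k)).
have E2 : (fun k => qext (F := R[i]) (twisted tau_letter (p k) (p k)) h) =
    (fun k => polylog (nabla h) (p k)).
  apply/funext => k; rewrite nabla_twist polylog_twist //.
  by have [] := tau_dom_Omega (pd k).
rewrite E1 in c1; rewrite E2 in c2.
have e3 := cvg_seq_unique c2 (lp (nabla h)).
have e4 := cvg_seq_unique c1 (cvg_cst _).
rewrite /extension_value -e4 e3; exact: lP.
Qed.

Lemma rho_facts : [/\ normc (rho R) = 1, complex.Re (rho R) = 2^-1,
  0 < complex.Im (rho R) & tau_map (rho R) = rho R].
Proof.
have pi0 := pi_gt0 R.
have rE : complex.Re (rho R) = cos (pi / 3).
  by rewrite /rho Re_cexp /= !mul0r !mul1r ?subr0 ?addr0 ?add0r ?subrr ?oppr0 expR0 mul1r.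
have iE : complex.Im (rho R) = sin (pi / 3).
  by rewrite /rho Im_cexp /= !mul0r !mul1r ?subr0 ?addr0 ?add0r ?subrr ?oppr0 expR0 mul1r.
have n1 : normc (rho R) = 1.
  by rewrite /rho normc_cexp /= !mul0r ?mul1r ?subr0 ?subrr expR0.
have c0 : 0 < cos (pi / 3 : R) by apply: cos_gt0_pihalf; apply/andP; split; lra.
have s0 : 0 < sin (pi / 3 : R) by apply: sin_gt0_pi; apply/andP; split; lra.
have cs := cos2Dsin2 (pi / 3 : R).
have c3 : cos (pi / 3 + (pi / 3 + pi / 3) : R) = -1.
  by rewrite -cospi; congr cos; lra.
have c12 : cos (pi / 3 : R) = 2^-1.
  move: c3; rewrite !cosD !sinD; move: (cos _) (sin _) c0 s0 cs => c s c0 s0 cs c3.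
  (* The triple angle formula at pi/3 reads 4 c^3 - 3 c = -1, and 4 c^3 - 3 c + 1 factors in this
     way. *)
  have : (c + 1) * (2 * c - 1) ^+ 2 = 0.
    have : s ^+ 2 = 1 - c ^+ 2 by rewrite -cs; ring.
    move=> s2; move: c3; nra.
  move=> /eqP; rewrite mulf_eq0 sqrf_eq0 => /orP[/eqP|/eqP]; lra.
split=> //; rewrite ?rE ?iE //.
have rho0 : rho R != 0 by exact: cexp_neq0.
(* The fixed-point equation of 1 - 1/z, cleared of denominators. *)
have E : rho R * (1 - rho R) = 1.
  move: rE iE; rewrite c12; move: (rho R) => [x y] /= -> ->.
  move: cs s0; rewrite c12; move: (sin _) => s cs s0.
  by apply: complexP => /=; nra.
have V : (rho R)^-1 = 1 - rho R by apply: (mulfI rho0); rewrite mulfV.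
by rewrite /tau_map V subKr.
Qed.

End Tau.

Theorem theorem7 (R : realType) (h : H) :
  [/\ zeta R h = polylog (square h) (2^-1 : (R[i])^o),
      extension_value (polylog (nabla h)) (rho R) (zeta_plus R h)
    & extension_value (polylog (nabla h)) (rho R)^-1 (zeta_minus R h)].
Proof.
have [n1 r12 i0 Tr] := rho_facts R.
have rho0 : rho R != 0 by exact: cexp_neq0.
(* The fixed-point equation for rho also yields the real part, the imaginary part and the
   fixed-point property of its inverse. *)
have V : (rho R)^-1 = 1 - rho R by move: Tr; rewrite /tau_map => {2}<-; rewrite subKr.
have e1 : (1 : R) = 1 \/ (1 : R) = -1 by left.
have eN1 : (-1 : R) = 1 \/ (-1 : R) = -1 by right.
split; first exact: zeta_half.
- have -> : zeta_plus R h = zeta_reg (Complex 0 (1 * pi)) h.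
    congr (zeta_reg _ h); rewrite mul1r; apply: complexP => /=; lra.
  by apply: (@zeta_tau_limit R 1 (rho R) h e1 n1 r12 _ Tr); rewrite mul1r.
- have -> : zeta_minus R h = zeta_reg (Complex 0 (-1 * pi)) h.
    congr (zeta_reg _ h); rewrite mulN1r; apply: complexP => /=; lra.
  apply: (@zeta_tau_limit R (-1) (rho R)^-1 h eN1).
  + by rewrite normcV n1 invr1.
  + by rewrite V ReB r12 /=; lra.
  + by rewrite V ImB [complex.Im 1]/= sub0r mulN1r opprK.
  + by rewrite /tau_map invrK V.
Qed.
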